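(* Let $q$ be an odd prime power. The group $K$ has exactly $2q+4$ orbits on points of $\mathrm{PG}(3, q^2)$, namely: (i) $\mathcal{O}$; (ii) $\Sigma_1$, with representative $S_1$; (iii) $\Sigma_2$, with representative $S_2$; (iv) $\mathcal{Q}^+(3, q^2) \setminus \mathcal{O}$, with representative $U$; (v) two orbits $\mathcal{H}_1$, $\mathcal{H}_2$ on points of $\mathcal{H}(3, q^2) \setminus \mathcal{O}$, with representatives $R_{\frac{q+1}{2}}$, $Q_{\frac{q-1}{2}}$ and of size $q^2(q^2+1)(q-1)/2$, $q^2(q^2+1)(q+1)/2$, respectively; (vi) $\mathcal{S}_j \setminus \mathcal{O}$, with representative $R_j$, for $j \in \{1, \dots, q\} \setminus \{(q+1)/2\}$; (vii) for $k \in \{1, \dots, q-2\} \setminus \{(q-1)/2\}$, the set $\mathcal{E}_k \setminus \mathcal{O}$ if $q \equiv 1 \pmod 4$, or $\mathcal{E}_{q-1-k}\setminus\mathcal{O}$ if $q \equiv -1 \pmod 4$, with representative $Q_k$; (viii) $\mathcal{E}_0 \setminus \Sigma$, with representative $T_1$ if $q \equiv 1 \pmod 4$ or $T_2$ if $q \equiv -1 \pmod 4$; (ix) $\mathcal{E}_{q-1} \setminus \Sigma$, with representative $T_1$ if $q \equiv -1 \pmod 4$ or $T_2$ if $q \equiv 1 \pmod 4$.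
   Context: $q$ is an odd prime power and $\xi$ is a fixed primitive element of $\mathbb{F}_{q^2}$. $\mathrm{PG}(3,q^2)$ has homogeneous coordinates $(X_1,X_2,X_3,X_4)$. $\mathcal{H}(3,q^2)$: $X_1^qX_4+X_1X_4^q-X_2^{q+1}-X_3^{q+1}=0$. $\mathcal{Q}^+(3,q^2)$: $X_1X_4-X_2X_3=0$. $\mathcal{O}=\{(1,t,t^q,t^{q+1}) : t\in\mathbb{F}_{q^2}\}\cup\{(0,0,0,1)\}$. $\Sigma=\{(a,b,b^q,c): a,c\in\mathbb{F}_q,\ b\in\mathbb{F}_{q^2}\}$ is a Baer subgeometry of $\mathrm{PG}(3,q^2)$, and $\mathcal{O}=\Sigma\cap\mathcal{Q}^+(3,q^2)=\Sigma\cap \mathcal{H}(3,q^2)=\mathcal{Q}^+(3,q^2)\cap \mathcal{H}(3,q^2)$. $K\cong \mathrm{PSL}(2,q^2)$ is the group of projectivities of $\mathrm{PG}(3,q^2)$ induced (on column vectors) by the Kronecker products $A^q\otimes A$, $A\in \mathrm{SL}(2,q^2)$, where $A^q$ is $A$ with all entries raised to the $q$-th power. $\Sigma_1,\Sigma_2$ denote the two $K$-orbits (of equal size) partitioning $\Sigma\setminus\mathcal{O}$, containing $S_1=(1,0,0,1)$ and $S_2=(1,0,0,\xi^{q+1})$ respectively. For $\gamma\in\mathbb{F}_{q^2}$ let $F_\gamma=X_1^q X_4 + X_1 X_4^q - X_2^{q+1} - X_3^{q+1} - \gamma (X_1 X_4 - X_2 X_3)^{\frac{q+1}{2}}$. For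 $j\in\{1,\dots,q\}\setminus\{(q+1)/2\}$, $\mathcal{S}_j$ is the set of points with $F_\gamma=0$, $\gamma=\xi^{j\frac{q-1}{2}}+\xi^{-j\frac{q-1}{2}}$; for $k\in\{0,\dots,q-1\}\setminus\{(q-1)/2\}$, $\mathcal{E}_k$ is the set of points with $F_\gamma=0$, $\gamma=\xi^{k\frac{q+1}{2}}+\xi^{-k\frac{q+1}{2}}$. Points: $U=(0,1,0,0)$, $T_1=(\xi,1,1,0)$, $T_2=(\xi^{q-1},\xi^{q-1},1,0)$, $R_j=(\xi^j,0,0,1)$ for $j\in\{1,\dots,q\}$, $Q_k=(0,\xi^k,1,0)$ for $k\in\{1,\dots,q-2\}$. *)

(* Defs.v *)
From HB Require Import structures.
From mathcomp Require Import all_boot all_algebra all_fingroup finfield.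
From mathcomp Require Import mxtens.

Set Implicit Arguments.
Unset Strict Implicit.
Unset Printing Implicit Defensive.

Import GRing.Theory.
Local Open Scope ring_scope.

Section FiniteVspace.

Import VectorInternalTheory.

HB.instance Definition _ (F : finFieldType) (vT : vectType F) :=
  [Countable of {vspace vT} by <:].
HB.instance Definition _ (F : finFieldType) (vT : vectType F) :=
  [Finite of {vspace vT} by <:].

End FiniteVspace.

Section ProjectiveSpace.

Variable F : finFieldType.

Record point := Point {
  line :> {vspace 'cV[F]_4};
  _ : \dim line == 1
}.

HB.instance Definition _ := [isSub for line].
HB.instance Definition _ := [Finite of point by <:].

Definition vec (x1 x2 x3 x4 : F) : 'cV[F]_4 :=
  \col_(i < 4) [:: x1; x2; x3; x4]`_i.

Lemma dim_line_e1 : \dim <[vec 1 0 0 0]> == 1.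
Proof.
rewrite dim_vline eqb1; apply/eqP => /matrixP/(_ 0 0)/eqP.
by rewrite !mxE /= oner_eq0.
Qed.

(* The zero vector has no projective meaning; it is sent to the point
   (1, 0, 0, 0). *)
Definition pt (v : 'cV[F]_4) : point := insubd (Point dim_line_e1) <[v]>%VS.

Lemma line_pt v : v != 0 -> pt v = <[v]>%VS :> {vspace _}.
Proof. by move=> nz_v; rewrite val_insubd dim_vline nz_v. Qed.

Lemma lker_GL (g : {'GL_4[F]}) :
  lker (linfun (mulmx (val g) : 'cV[F]_4 -> 'cV[F]_4)) == 0%VS.
Proof.
apply/lker0P => u v; rewrite !lfunE /= => /(congr1 (mulmx (invmx (val g)))).
by rewrite !mulKmx //; exact: (valP g).
Qed.

Lemma dim_image_line (g : {'GL_4[F]}) (P : point) :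
  \dim (linfun (mulmx (val g)) @: line P)%VS == 1.
Proof.
by case: P => V /= dV; rewrite limg_dim_eq // (eqP (lker_GL g)) capv0.
Qed.

Definition projectivity_fun (g : {'GL_4[F]}) (P : point) : point :=
  Point (dim_image_line g P).

Lemma projectivity_inj (g : {'GL_4[F]}) : injective (projectivity_fun g).
Proof.
move=> P1 P2 /(congr1 val)/eqP /=.
by rewrite eq_limg_ker0 ?lker_GL // => /eqP/val_inj.
Qed.

Definition projectivity (g : {'GL_4[F]}) : {perm point} :=
  perm (@projectivity_inj g).

(* Only used for f with f (a *: v) = a ^+ m * f v, m > 0, a in F, so that all
   homogeneous coordinate vectors of a point vanish together, and f 0 = 0. *)
Definition locus (f : 'cV[F]_4 -> F) : {set point} :=
  [set P : point | [forall v, (v \in line P) ==> (f v == 0)]].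

End ProjectiveSpace.

Section Configuration.

Variables (F : finFieldType) (q : nat) (xi : F).
Implicit Types X : 'cV[F]_4.

Definition frobmx m n (A : 'M[F]_(m, n)) : 'M[F]_(m, n) :=
  map_mx (fun x => x ^+ q) A.

(* The entry of B *t A in row 2 * i + k and column 2 * j + l is B i j * A k l
   (indices from 0), which is the usual block form of the Kronecker product. *)
Definition kron_sl2 (A : 'M[F]_2) : 'M[F]_4 := frobmx A *t A.

Definition groupK : {set {perm point F}} :=
  [set projectivity g |
    g : {'GL_4[F]} & [exists A : 'M[F]_2, (\det A == 1) && (val g == kron_sl2 A)]].

Definition K_orbit (P : point F) : {set point F} := orbit 'P groupK P.

Definition K_orbits : {set {set point F}} := [set K_orbit P | P : point F].

(* X 0 0, ..., X 3 0 are the homogeneous coordinates X_1, ..., X_4. *)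
Definition herm_form X : F :=
  X 0 0 ^+ q * X 3 0 + X 0 0 * X 3 0 ^+ q - X 1 0 ^+ q.+1 - X 2 0 ^+ q.+1.

Definition quad_form X : F := X 0 0 * X 3 0 - X 1 0 * X 2 0.

Definition pencil_form (gamma : F) X : F :=
  herm_form X - gamma * quad_form X ^+ (q.+1)./2.

Definition herm_surface : {set point F} := locus herm_form.

Definition quadric : {set point F} := locus quad_form.

Definition ovoid : {set point F} :=
  pt (vec 0 0 0 1) |: [set pt (vec 1 t (t ^+ q) (t ^+ q.+1)) | t : F].

(* F_q is realised inside F as the set of solutions of x ^+ q = x. *)
Definition baer : {set point F} :=
  [set P : point F | [exists a : F, exists b : F, exists c : F,
    [&& a ^+ q == a, c ^+ q == c, vec a b (b ^+ q) c != 0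
      & P == pt (vec a b (b ^+ q) c)]]].

Definition ptS1 : point F := pt (vec 1 0 0 1).
Definition ptS2 : point F := pt (vec 1 0 0 (xi ^+ q.+1)).
Definition ptU : point F := pt (vec 0 1 0 0).
Definition ptT1 : point F := pt (vec xi 1 1 0).
Definition ptT2 : point F := pt (vec (xi ^+ q.-1) (xi ^+ q.-1) 1 0).
Definition ptR (j : nat) : point F := pt (vec (xi ^+ j) 0 0 1).
Definition ptQ (k : nat) : point F := pt (vec 0 (xi ^+ k) 1 0).

(* These are the two parts of baer :\: ovoid only when F has order q ^ 2 and xi
   is primitive, a fact that is asserted where they are used. *)
Definition Sigma1 : {set point F} := K_orbit ptS1.
Definition Sigma2 : {set point F} := K_orbit ptS2.

Definition surfS (j : nat) : {set point F} :=
  locus (pencil_form (xi ^+ (j * (q.-1)./2) + xi ^- (j * (q.-1)./2))).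

Definition surfE (k : nat) : {set point F} :=
  locus (pencil_form (xi ^+ (k * (q.+1)./2) + xi ^- (k * (q.+1)./2))).

End Configuration.

Section KGroup.

Variables (F : finFieldType) (p e : nat).
Hypotheses (p_pr : prime p) (cardF : #|F| = ((p ^ e) ^ 2)%N).
Let q := (p ^ e)%N.

Lemma frobmxM m n r (A : 'M[F]_(m, n)) (B : 'M[F]_(n, r)) :
  frobmx q (A *m B) = frobmx q A *m frobmx q B.
Proof.
have pF : [pchar F].-nat q.
  rewrite pnatX; apply/orP; left; rewrite pnatE //.
  by apply: (card_finPcharP (n := e * 2)); rewrite // expnM.
have q_gt0 : (0 < q)%N by rewrite expn_gt0 prime_gt0.
apply/matrixP => i j; rewrite !mxE.
rewrite (big_morph _ (id1 := 0) (op1 := +%R)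
          (fun x y => exprDn_pchar x y pF)) ?expr0n -?lt0n ?q_gt0 //; last first.
  by case: (q) q_gt0.
by apply: eq_bigr => k _; rewrite !mxE exprMn.
Qed.

Lemma group_set_groupK : group_set (groupK F q).
Proof.
have KP s : reflect (exists2 g : {'GL_4[F]}, s = projectivity g &
    exists2 A : 'M[F]_2, \det A = 1 & val g = kron_sl2 q A) (s \in groupK F q).
  apply: (iffP imsetP) => [[g] | [g -> [A dA gA]]].
    by rewrite inE => /existsP[A /andP[/eqP dA /eqP gA]] ->; exists g => //; exists A.
  by exists g => //; rewrite inE; apply/existsP; exists A; rewrite dA gA !eqxx.
have q_gt0 : (0 < q)%N by rewrite expn_gt0 prime_gt0.
apply/group_setP; split => [|s t /KP[g -> [A dA gA]] /KP[h -> [B dB hB]]].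
  apply/KP; exists 1%g.
    apply/permP => P; rewrite perm1 permE; apply: val_inj => /=.
    rewrite -[LHS]lim1g; apply: eq_in_limg => v _.
    by rewrite !lfunE /= mul1mx.
  exists 1%:M; first exact: det1.
  apply/matrixP => i j; case: (mxtens_indexP (i : 'I_(2 * 2))) => i0 i1.
  case: (mxtens_indexP (j : 'I_(2 * 2))) => j0 j1.
  rewrite [RHS](tensmxE (frobmx q 1%:M) 1%:M) !mxE.
  rewrite (can_eq (@mxtens_indexK 2 2)) xpair_eqE.
  by case: eqP; case: eqP; rewrite ?mulr0 ?expr1n ?mulr1 // expr0n gtn_eqF ?mul0r //.
apply/KP; exists (h * g)%g.
  apply/permP => P; rewrite permM !permE; apply: val_inj => /=.
  rewrite -limg_comp; apply: eq_in_limg => v _.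
  by rewrite comp_lfunE !lfunE /= mulmxA.
exists (B *m A); first by rewrite det_mulmx dA dB mulr1.
rewrite /kron_sl2 frobmxM -tensmx_mul.
by rewrite -[frobmx _ _ *t _]/(kron_sl2 q B) -[X in _ *m X]/(kron_sl2 q A) -gA -hB.
Qed.

End KGroup.

(* Main.v *)
(** A point is a 2 x 2 matrix M over F = F_{q^2} up to scalars (rows (X1, X2) and
    (X3, X4)), on which A in SL(2, q^2) acts by M |-> A^(q) M A^T, so M is a
    sesquilinear form on F^2. Writing d for quad_form and h for herm_form,
    det (M - t M^* ) = d - t h + t^2 d^q; hence d and h are K-invariant, and so
    is every surface of the pencil. Sigma consists of the Hermitian forms up to
    scalars, O of those of rank one. Off the quadric a point determines the
    exponent 0 <= n <= (q^2 - 1) / 2 (its level) with gamma = xi^n + xi^-n.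

    A form of rank one is u^(q) w^T, which gives O (u, w proportional) or the
    orbit of U. For rank two, the pencil spanned by M and M^* contains a singular
    form over F; a vector in its left kernel is either non-isotropic, and M is
    then diagonal in a basis containing it, or isotropic. Diagonal forms
    diag(x, 1) depend on x modulo 2 (q + 1)-th powers and inversion, which
    leaves S1, S2 and the R_j. A form with an isotropic vector has off-diagonal
    entries of different norms, and is then antidiagonal in a suitable basis (the
    Q_k), or of equal norms, and is then Hermitian up to a scalar or in the orbit
    of T1 or T2.

    Levels, membership in Sigma and, for the two orbits of level (q^2 - 1) / 4,
    sizes computed from stabilisers in SL(2, q^2), distinguish the
    representatives. *)

Require Import Defs.
From mathcomp Require Import all_boot all_algebra all_fingroup.
From mathcomp Require Import mxtens finfield ring zify.

Set Implicit Arguments.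
Unset Strict Implicit.
Unset Printing Implicit Defensive.

Import GRing.Theory.
Local Open Scope ring_scope.

(** * Arithmetic of levels *)

Section HalfArithmetic.

Local Open Scope nat_scope.

Lemma mul_half_range m j : 0 < m -> 0 < j < (m * 2).+2 -> 0 < j * m < 2 * m * m.+1.
Proof.
move=> m0 /andP[j0 jm].
by rewrite muln_gt0 j0 m0 -mulnA [m * _]mulnC mulnA ltn_pmul2r //; lia.
Qed.

Lemma mul_half_succ_range m k : 0 < k < 2 * m -> 0 < k * m.+1 < 2 * m * m.+1.
Proof. by case/andP=> k0 km; rewrite muln_gt0 k0 ltn_pmul2r. Qed.

(** As m and m + 1 are coprime, m + 1 divides j, and the range leaves only j = m + 1. With m = (q -
    1) / 2 the two products are the levels of the S_j and of the E_k, so these families share the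
    single level m (m + 1). *)
Lemma mul_half_meet m j k : 0 < m -> 0 < j < (m * 2).+2 -> 0 < k < 2 * m ->
  j * m = k * m.+1 -> j = m.+1 /\ k = m.
Proof.
move=> m0 j_lt k_lt E.
have : (m.+1 %| j)%N.
  by rewrite -(@Gauss_dvdl _ _ m) ?coprimeSn // E dvdn_mull.
case/dvdnP=> [[|[|t]]] jE; [lia | | nia].
rewrite mul1n in jE; split=> //; apply/eqP; rewrite -(eqn_pmul2r (ltn0Sn m)).
by rewrite -E jE mulnC.
Qed.

Lemma pred_pow4 q : (q ^ 4 - 1 = (q ^ 2 + 1) * (q - 1) * q.+1)%N.
Proof.
have sqr1 n : (n ^ 2 - 1 = (n - 1) * (n + 1))%N.
  by rewrite -[X in (_ - X)%N](exp1n 2) subn_sqr.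
by rewrite (expnM q 2 2) !sqr1 addn1 mulnC mulnA.
Qed.

End HalfArithmetic.

(** * Points and coordinates *)

Section Points.

Variable F : finFieldType.
Implicit Types (v w : 'cV[F]_4) (P : point F).

Lemma pt_surj P : exists2 v, v != 0 & P = pt v.
Proof.
have nz_v : vpick (line P) != 0.
  by rewrite vpick0 -dimv_eq0; case: P => V /= /eqP->.
exists (vpick (line P)) => //; apply/val_inj/eqP; rewrite /= line_pt //.
rewrite eq_sym eqEdim -memvE memv_pick dim_vline nz_v.
by case: P {nz_v} => V /= /eqP->.
Qed.

Lemma eq_ptP v w : v != 0 -> w != 0 ->
  reflect (exists2 k, k != 0 & v = k *: w) (pt v == pt w).
Proof.
move=> v0 w0; apply: (iffP eqP) => [/(congr1 val) /= | [k k0 ->]].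
  rewrite !line_pt // => eq_vw.
  have /vlineP[k def_v] : v \in <[w]>%VS by rewrite -eq_vw memv_line.
  by exists k => //; apply: contraNneq v0 => k0; rewrite def_v k0 scale0r.
apply: val_inj; rewrite /= !line_pt ?scaler_eq0 ?negb_or ?k0 //.
apply/eqP; rewrite eqEdim -memvE memvZ ?memv_line //.
by rewrite !dim_vline scaler_eq0 (negPf k0) (negPf w0).
Qed.

Lemma pt_scale k v : k != 0 -> v != 0 -> pt (k *: v) = pt v.
Proof.
by move=> k0 v0; apply/eqP/eq_ptP; rewrite ?scaler_eq0 ?negb_or ?k0 //; exists k.
Qed.

Lemma projectivity_pt (g : {'GL_4[F]}) v :
  v != 0 -> projectivity g (pt v) = pt (val g *m v).
Proof.
move=> v0; have gv0 : val g *m v != 0.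
  apply: contraNneq v0 => /(congr1 (mulmx (invmx (val g)))).
  by rewrite mulKmx ?mulmx0 => [->|]; last exact: (valP g).
by rewrite permE; apply: val_inj; rewrite /= !line_pt // limg_line lfunE.
Qed.

(** Homogeneity lets one coordinate vector decide. The degree is positive because [locus] also tests
    the zero vector of the line. *)
Lemma mem_locus (f : 'cV[F]_4 -> F) m v :
    (forall k w, f (k *: w) = k ^+ m.+1 * f w) ->
  v != 0 -> (pt v \in locus f) = (f v == 0).
Proof.
move=> fZ v0; rewrite inE line_pt //; apply/forallP/eqP => [fv|fv0 w].
  by apply/eqP; apply: (implyP (fv v)); rewrite memv_line.
by apply/implyP=> /vlineP[k ->]; rewrite fZ fv0 mulr0.
Qed.

Lemma vecE v : v = vec (v 0 0) (v 1 0) (v 2 0) (v 3 0).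
Proof.
by apply/colP=> i; rewrite !mxE; case: i => [[|[|[|[|]]]]] //= lti;
   congr (v _ _); apply: val_inj.
Qed.

Lemma scale_vec k x1 x2 x3 x4 :
  k *: vec x1 x2 x3 x4 = vec (k * x1) (k * x2) (k * x3) (k * x4) :> 'cV[F]_4.
Proof. by rewrite [LHS]vecE !mxE. Qed.

Lemma vec_inj (x1 x2 x3 x4 y1 y2 y3 y4 : F) :
  vec x1 x2 x3 x4 = vec y1 y2 y3 y4 -> [/\ x1 = y1, x2 = y2, x3 = y3 & x4 = y4].
Proof.
move/colP=> E; move: (E 0) (E 1) (E 2) (E 3).
by rewrite !mxE /= => -> -> -> ->.
Qed.

Lemma vec_eq0 (x1 x2 x3 x4 : F) :
  (vec x1 x2 x3 x4 == 0) = [&& x1 == 0, x2 == 0, x3 == 0 & x4 == 0].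
Proof.
apply/eqP/and4P => [/colP E | [/eqP-> /eqP-> /eqP-> /eqP->]].
  by move: (E 0) (E 1) (E 2) (E 3); rewrite !mxE /= => -> -> -> ->.
by apply/colP=> i; rewrite !mxE; case: i => [[|[|[|[|]]]]].
Qed.

Definition mx2 (a b c d : F) : 'M[F]_2 :=
  \matrix_(i, j) (nth [::] [:: [:: a; b]; [:: c; d]] i)`_j.

Lemma mx2E (A : 'M[F]_2) : A = mx2 (A 0 0) (A 0 1) (A 1 0) (A 1 1).
Proof.
apply/matrixP=> i j; rewrite !mxE.
by case: i => [[|[|]]] //= lti; case: j => [[|[|]]] //= ltj;
   congr (A _ _); apply: val_inj.
Qed.

Lemma mx2_inj a b c d a' b' c' d' :
  mx2 a b c d = mx2 a' b' c' d' -> [/\ a = a', b = b', c = c' & d = d'].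
Proof.
move/matrixP=> E; move: (E 0 0) (E 0 1) (E 1 0) (E 1 1).
by rewrite !mxE /= => -> -> -> ->.
Qed.

Lemma det_mx2 a b c d : \det (mx2 a b c d) = a * d - b * c.
Proof.
rewrite (expand_det_row _ 0) !big_ord_recl big_ord0 /cofactor !det_mx11 !mxE /=.
by rewrite /bump /= !addn0 expr0 expr1; ring.
Qed.

Variable q : nat.

Lemma kron_sl2_vec a b c d x1 x2 x3 x4 :
  kron_sl2 q (mx2 a b c d) *m vec x1 x2 x3 x4 =
  vec (a ^+ q * (x1 * a + x2 * b) + b ^+ q * (x3 * a + x4 * b))
      (a ^+ q * (x1 * c + x2 * d) + b ^+ q * (x3 * c + x4 * d))
      (c ^+ q * (x1 * a + x2 * b) + d ^+ q * (x3 * a + x4 * b))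
      (c ^+ q * (x1 * c + x2 * d) + d ^+ q * (x3 * c + x4 * d)).
Proof.
rewrite [LHS]vecE !mxE !big_ord_recl !big_ord0 !mxE /=.
by congr vec; ring.
Qed.

Lemma herm_form_vec x1 x2 x3 x4 :
  herm_form q (vec x1 x2 x3 x4 : 'cV[F]_4) =
  x1 ^+ q * x4 + x1 * x4 ^+ q - x2 * x2 ^+ q - x3 * x3 ^+ q.
Proof. by rewrite /herm_form !mxE /= !exprS. Qed.

Lemma quad_form_vec x1 x2 x3 x4 :
  quad_form (vec x1 x2 x3 x4 : 'cV[F]_4) = x1 * x4 - x2 * x3.
Proof. by rewrite /quad_form !mxE. Qed.

Lemma quad_formZ k v : quad_form (k *: v) = k ^+ 2 * quad_form v.
Proof. rewrite (vecE v) scale_vec !quad_form_vec; ring. Qed.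

Lemma herm_formZ k v : herm_form q (k *: v) = k ^+ q.+1 * herm_form q v.
Proof. rewrite (vecE v) scale_vec !herm_form_vec !exprMn exprS; ring. Qed.

End Points.

(** * Frobenius and the action of K *)

Section Orbits.

Variables (p e q : nat) (F : finFieldType) (xi : F).
Hypotheses (p_prime : prime p) (q_def : q = (p ^ e)%N).
Hypotheses (q_odd : odd q) (cardF : #|F| = (q ^ 2)%N).
Hypothesis xi_primitive : ((q ^ 2).-1).-primitive_root xi.
Implicit Types (a b x y : F) (v : 'cV[F]_4) (P X : point F) (A B : 'M[F]_2).

Lemma pchar_nat_q : [pchar F].-nat q.
Proof.
rewrite q_def pnatX; apply/orP; left; rewrite pnatE //.
by apply: (card_finPcharP (n := e * 2)); rewrite // expnM -q_def.
Qed.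

Lemma frobD x y : (x + y) ^+ q = x ^+ q + y ^+ q.
Proof. exact: exprDn_pchar pchar_nat_q. Qed.

Lemma frobN x : (- x) ^+ q = - x ^+ q.
Proof. exact: exprNn_pchar pchar_nat_q. Qed.

Lemma frobB x y : (x - y) ^+ q = x ^+ q - y ^+ q.
Proof. by rewrite frobD frobN. Qed.

Lemma frobK x : (x ^+ q) ^+ q = x.
Proof. by rewrite -exprM mulnn -cardF expf_card. Qed.

Lemma q_gt2 : (2 < q)%N.
Proof.
have := card_finRing_gt1 F; rewrite cardF.
by case: q q_odd => [|[|[|n]]].
Qed.

Lemma q_gt0 : (0 < q)%N. Proof. exact: ltnW (ltnW q_gt2). Qed.

Let m := q./2.

Lemma q_half : q = (m * 2).+1.
Proof. by rewrite -[LHS]odd_double_half q_odd muln2. Qed.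

Lemma m_gt0 : (0 < m)%N. Proof. by have := q_gt2; have := q_half; lia. Qed.

Lemma half_succ_q : (q.+1)./2 = m.+1. Proof. by have := q_half; lia. Qed.

Lemma half_pred_q : (q.-1)./2 = m. Proof. by have := q_half; lia. Qed.

Lemma pred_q : q.-1 = (2 * m)%N. Proof. by have := q_half; lia. Qed.

Lemma pred_sqr_q : (q ^ 2).-1 = (4 * m * m.+1)%N.
Proof. by have := q_half; nia. Qed.

Lemma half_pred_sqr_q : (q ^ 2).-1./2 = (2 * m * m.+1)%N.
Proof. by rewrite pred_sqr_q; nia. Qed.

(** As q = 2 m + 1, the case split on q modulo 4 is a split on the parity of m, which governs the
    sign of (-1)^m. *)
Lemma mod4E : (q %% 4 == 1)%N = ~~ odd m.
Proof. have := q_half; have := odd_double_half m; case: (odd m); lia. Qed.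

(** The norm of xi^i is xi^((q + 1) i), so this is the criterion for xi^i to have norm 1. *)
Lemma dvdn_pred_sqr_q1 i : ((q ^ 2).-1 %| q.+1 * i)%N = (q.-1 %| i)%N.
Proof.
rewrite pred_q pred_sqr_q; have -> : (4 * m * m.+1 = q.+1 * (2 * m))%N.
  by have := q_half; nia.
by rewrite dvdn_pmul2l.
Qed.

(** A nonzero x lies in F_q when x^(q - 1) = 1, so this is the criterion for xi^i to lie in F_q. *)
Lemma dvdn_pred_sqr_q2 i : ((q ^ 2).-1 %| q.-1 * i)%N = (q.+1 %| i)%N.
Proof.
have -> : ((q ^ 2).-1 = q.-1 * q.+1)%N by have := q_half; nia.
by rewrite dvdn_pmul2l // pred_q muln_gt0 m_gt0.
Qed.

Lemma succ_q : q.+1 = (2 * m.+1)%N.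
Proof. by have := q_half; rewrite -/m; lia. Qed.

Lemma frob0 : 0 ^+ q = 0 :> F.
Proof. by rewrite expr0n gtn_eqF ?q_gt0. Qed.

Lemma frob_eq0 x : (x ^+ q == 0) = (x == 0).
Proof. by rewrite expf_eq0 q_gt0. Qed.

Lemma two_neq0 : 2 != 0 :> F.
Proof.
(* In characteristic 2, q would be a power of 2; being odd it would be 1, against q > 2. *)
apply/eqP=> two0; suff: (2 \in [pchar F]).
  move=> char2; have := pchar_nat_q; rewrite (eq_pnat _ (pcharf_eq char2)).
  by move/p_natP=> [n q2]; move: q_odd q_gt2; rewrite q2 oddX orbF => /eqP->.
by rewrite inE /= two0 eqxx.
Qed.

Definition frobE := (frobD, frobN, exprMn, frobK, frob0, expr1n).

Lemma frobmx_mx2 (a b c d : F) :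
  frobmx q (mx2 a b c d) = mx2 (a ^+ q) (b ^+ q) (c ^+ q) (d ^+ q).
Proof. by rewrite [LHS]mx2E !mxE. Qed.

Lemma det_frobmx A : \det (frobmx q A) = \det A ^+ q.
Proof. by rewrite (mx2E A) frobmx_mx2 !det_mx2 !frobE. Qed.

Lemma kron_sl2M A B : kron_sl2 q (A *m B) = kron_sl2 q A *m kron_sl2 q B.
Proof.
have cardF' : #|F| = ((p ^ e) ^ 2)%N by rewrite cardF q_def.
by rewrite /kron_sl2 q_def (frobmxM p_prime cardF') -tensmx_mul.
Qed.

Lemma kron_sl2_unit A : \det A != 0 -> kron_sl2 q A \in unitmx.
Proof.
move=> dA; have uA : A \in unitmx by rewrite unitmxE unitfE.
have uAq : frobmx q A \in unitmx by rewrite unitmxE unitfE det_frobmx frob_eq0.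
exact: (@tensmx_unit F 2 2 (frobmx q A) A isT isT uAq uA).
Qed.

Lemma kron_sl2_neq0 A v : \det A != 0 -> v != 0 -> kron_sl2 q A *m v != 0.
Proof.
move=> dA; apply: contraNneq => /(congr1 (mulmx (invmx (kron_sl2 q A)))).
by rewrite mulKmx ?kron_sl2_unit // mulmx0 => ->.
Qed.

Lemma det1_neq0 A : \det A = 1 -> \det A != 0.
Proof. by move->; rewrite oner_neq0. Qed.

Lemma kron_sl2_1 v : kron_sl2 q 1%:M *m v = v.
Proof.
rewrite (mx2E 1%:M) (vecE v) kron_sl2_vec !mxE /= expr1n frob0.
by congr vec; ring.
Qed.

Lemma quad_form_kron A v :
  quad_form (kron_sl2 q A *m v) = \det A ^+ q.+1 * quad_form v.
Proof.
rewrite (mx2E A) (vecE v) kron_sl2_vec !quad_form_vec det_mx2 exprS !frobE.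
ring.
Qed.

Lemma herm_form_kron A v :
  herm_form q (kron_sl2 q A *m v) = \det A ^+ q.+1 * herm_form q v.
Proof.
rewrite (mx2E A) (vecE v) kron_sl2_vec !herm_form_vec det_mx2 exprS !frobE.
ring.
Qed.

Lemma K_orbitP v X :
  v != 0 ->
  reflect (exists2 A, \det A = 1 & X = pt (kron_sl2 q A *m v))
          (X \in K_orbit q (pt v)).
Proof.
move=> v0; apply: (iffP imsetP) => [[_ /imsetP[g + ->] ->] | [A dA ->]].
  rewrite inE => /existsP[A /andP[/eqP dA /eqP gA]].
  by exists A; rewrite //= apermE projectivity_pt // gA.
have uA := kron_sl2_unit (det1_neq0 dA).
pose g : {'GL_4[F]} := Sub (kron_sl2 q A : 'M_4) uA.
exists (projectivity g); last by rewrite /= apermE projectivity_pt.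
by apply/imsetP; exists g; rewrite // inE; apply/existsP; exists A; rewrite dA !eqxx.
Qed.

Lemma mem_K_orbit v w A :
    \det A = 1 -> v != 0 -> (exists2 k, k != 0 & kron_sl2 q A *m v = k *: w) ->
  pt w \in K_orbit q (pt v).
Proof.
move=> dA v0 [k k0 Av]; apply/K_orbitP => //; exists A => //.
have := kron_sl2_neq0 (det1_neq0 dA) v0.
by rewrite Av scaler_eq0 negb_or => /andP[_ w0]; rewrite pt_scale.
Qed.

Lemma K_orbit_eqP P X : reflect (K_orbit q P = K_orbit q X) (P \in K_orbit q X).
Proof.
have cardF' : #|F| = ((p ^ e) ^ 2)%N by rewrite cardF q_def.
have gK : group_set (groupK F q) by rewrite q_def; apply: group_set_groupK.
exact: (orbit_eqP (G := Group gK)).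
Qed.

Lemma K_orbit_refl P : P \in K_orbit q P.
Proof. by apply/K_orbit_eqP. Qed.

Lemma K_orbit_sym P X : (P \in K_orbit q X) = (X \in K_orbit q P).
Proof. by apply/K_orbit_eqP/K_orbit_eqP => ->. Qed.

Lemma K_orbit_trans P X Y :
  P \in K_orbit q X -> X \in K_orbit q Y -> P \in K_orbit q Y.
Proof. by move/K_orbit_eqP=> PX /K_orbit_eqP XY; apply/K_orbit_eqP; rewrite PX. Qed.

Lemma mem_quadric v : v != 0 -> (pt v \in quadric F) = (quad_form v == 0).
Proof. by apply: (mem_locus (m := 1)); apply: quad_formZ. Qed.

Lemma mem_herm_surface v :
  v != 0 -> (pt v \in herm_surface F q) = (herm_form q v == 0).
Proof. by apply: (mem_locus (m := q)); apply: herm_formZ. Qed.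

Lemma mem_pencil (gamma : F) v :
  v != 0 -> (pt v \in locus (pencil_form q gamma)) =
    (herm_form q v == gamma * quad_form v ^+ (q.+1)./2).
Proof.
move=> v0; rewrite (mem_locus (m := q)) ?subr_eq0 // => k w.
rewrite /pencil_form herm_formZ quad_formZ exprMn -exprM.
(* As q is odd, d^((q + 1) / 2) has degree exactly q + 1, the degree of h. *)
have -> : (2 * q.+1./2 = q.+1)%N by rewrite mul2n -[RHS]odd_double_half /= q_odd.
by ring.
Qed.

Lemma K_orbit_quadric P X : P \in K_orbit q X -> (P \in quadric F) = (X \in quadric F).
Proof.
have [v v0 ->] := pt_surj X => /(K_orbitP _ v0)[A dA ->].
rewrite !mem_quadric ?kron_sl2_neq0 ?det1_neq0 //.
by rewrite quad_form_kron dA expr1n mul1r.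
Qed.

Lemma K_orbit_pencil (gamma : F) P X : P \in K_orbit q X ->
  (P \in locus (pencil_form q gamma)) = (X \in locus (pencil_form q gamma)).
Proof.
have [v v0 ->] := pt_surj X => /(K_orbitP _ v0)[A dA ->].
rewrite !mem_pencil ?kron_sl2_neq0 ?det1_neq0 //.
by rewrite herm_form_kron quad_form_kron dA expr1n !mul1r.
Qed.

Lemma baerP P : reflect
  (exists a b c, [/\ a ^+ q = a, c ^+ q = c, vec a b (b ^+ q) c != 0
     & P = pt (vec a b (b ^+ q) c)]) (P \in baer F q).
Proof.
rewrite inE; apply: (iffP existsP) => [[a /existsP[b /existsP[c]]] | [a [b [c]]]].
  by case/and4P=> /eqP aq /eqP cq v0 /eqP->; exists a, b, c.
case=> aq cq v0 ->; exists a; apply/existsP; exists b; apply/existsP; exists c.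
by rewrite aq cq v0 !eqxx.
Qed.

(** The action M |-> A^(q) M A^T commutes with conjugate transposition, so it keeps Hermitian
    matrices. One inclusion suffices because lying in the same orbit is symmetric. *)
Lemma K_orbit_baer P X : P \in K_orbit q X -> (P \in baer F q) = (X \in baer F q).
Proof.
suff sub Y Z : Y \in K_orbit q Z -> Z \in baer F q -> Y \in baer F q.
  by move=> PX; apply/idP/idP; apply: sub; rewrite // K_orbit_sym.
move=> + /baerP[a [b [c [aq cq v0 def_Z]]]]; rewrite def_Z.
case/K_orbitP=> // A dA ->; have := kron_sl2_neq0 (det1_neq0 dA) v0.
rewrite (mx2E A) kron_sl2_vec.
set y1 := (X in vec X); set y2 := (X in vec _ X); set y3 := (X in vec _ _ X).
set y4 := (X in vec _ _ _ X); move=> y0; apply/baerP; exists y1, y2, y4.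
have def_y3 : y2 ^+ q = y3 by rewrite /y2 /y3 !frobE aq cq; ring.
by rewrite def_y3; split=> //; rewrite /y1 /y4 !frobE ?aq ?cq; ring.
Qed.

(** These identities hold for Hermitian matrices and are homogeneous, so they survive scaling. Each
    representative outside Sigma violates one of them. *)
Lemma baer_vec x1 x2 x3 x4 : vec x1 x2 x3 x4 != 0 :> 'cV[F]_4 ->
    pt (vec x1 x2 x3 x4) \in baer F q ->
  [/\ x1 ^+ q * x4 = x1 * x4 ^+ q, x2 * x2 ^+ q = x3 * x3 ^+ q
    & x1 ^+ q * x3 = x2 ^+ q * x1].
Proof.
move=> x0 /baerP[a [b [c [aq cq v0]]]] /eqP/eq_ptP[//|//|k k0].
rewrite scale_vec => /vec_inj[-> -> -> ->]; rewrite !frobE aq cq.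
by split; ring.
Qed.

(** The image of [vec 1 0 0 0] under A is the matrix u^(q) u^T, where u = (a, c) is the first column
    of A. Up to scalars only the ratio t = c / a matters, and a = 0 gives (0, 0, 0, 1). *)
Lemma ovoidE : ovoid F q = K_orbit q (pt (vec 1 0 0 0)).
Proof.
have e1_neq0 : vec 1 0 0 0 != 0 :> 'cV[F]_4 by rewrite vec_eq0 oner_eq0.
apply/setP=> P; rewrite !inE; apply/idP/(K_orbitP _ e1_neq0).
  case/predU1P=> [-> | /imsetP[t _ ->]].
    exists (mx2 0 1 (-1) 0); first by rewrite det_mx2; ring.
    by rewrite kron_sl2_vec !frobE; congr (pt (vec _ _ _ _)); ring.
  exists (mx2 1 0 t 1); first by rewrite det_mx2; ring.
  by rewrite kron_sl2_vec exprS !frobE; congr (pt (vec _ _ _ _)); ring.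
case=> A; rewrite (mx2E A) kron_sl2_vec det_mx2.
move: (A 0 0) (A 0 1) (A 1 0) (A 1 1) => a b c d dA ->.
have [a0 | a0] := eqVneq a 0; apply/predU1P; [left | right].
  rewrite a0 in dA *; have c0 : c != 0.
    by apply: contra_eq_neq dA => ->; rewrite mul0r mulr0 subr0 eq_sym oner_eq0.
  rewrite -[RHS](@pt_scale _ (c * c ^+ q)) ?mulf_neq0 ?frob_eq0 //.
    by rewrite scale_vec frob0; congr (pt (vec _ _ _ _)); ring.
  by rewrite vec_eq0 oner_eq0 !andbF.
apply/imsetP; exists (c / a) => //; apply/esym.
rewrite -(@pt_scale _ (a * a ^+ q)) ?mulf_neq0 ?frob_eq0 ?vec_eq0 ?oner_eq0 //.
rewrite scale_vec exprS !exprMn exprVn.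
by congr (pt (vec _ _ _ _)); field; rewrite ?frob_eq0 ?a0.
Qed.

(** * Powers of the primitive element *)

Lemma xi_neq0 : xi != 0.
Proof.
apply: contra_eq_neq (prim_expr_order xi_primitive) => ->.
by rewrite expr0n gtn_eqF ?(prim_order_gt0 xi_primitive) // eq_sym oner_neq0.
Qed.

Lemma xiX_neq0 n : xi ^+ n != 0.
Proof. by rewrite expf_neq0 ?xi_neq0. Qed.

Lemma xi_log x : x != 0 -> exists i, x = xi ^+ i.
Proof.
move=> x0; have [|i ->] := prim_rootP xi_primitive (x := x); last by exists i.
apply: (mulfI x0); rewrite -exprS mulr1 prednK -?cardF ?expf_card //.
by rewrite cardF expn_gt0; case: q q_gt2.
Qed.

Lemma xiX_eq i j : (xi ^+ i == xi ^+ j) = (i == j %[mod (q ^ 2).-1]).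
Proof. exact: eq_prim_root_expr. Qed.

Lemma xiX_eq1 i : (xi ^+ i == 1) = ((q ^ 2).-1 %| i)%N.
Proof. by rewrite -(prim_order_dvd xi_primitive). Qed.

Lemma xi_half : xi ^+ (q ^ 2).-1./2 = -1.
Proof.
have half2 : ((q ^ 2).-1./2 * 2 = (q ^ 2).-1)%N.
  by rewrite half_pred_sqr_q pred_sqr_q; lia.
have /eqP : (xi ^+ (q ^ 2).-1./2) ^+ 2 = 1 by rewrite -exprM half2 prim_expr_order.
rewrite sqrf_eq1 => /orP[|/eqP //]; rewrite xiX_eq1.
by rewrite half_pred_sqr_q pred_sqr_q gtnNdvd -?mulnA ?ltn_pmul2r ?muln_gt0 ?m_gt0.
Qed.

(** The nonzero elements of F_q are the powers of xi^(q + 1), and q + 1 is even. *)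
Lemma frob_fixed_sqr x : x ^+ q = x -> exists s, s ^+ 2 = x.
Proof.
have [-> _ | x0 xq] := eqVneq x 0; first by exists 0; rewrite expr0n.
have [i def_x] := xi_log x0.
have /eqP : x ^+ q.-1 = 1.
  by apply: (mulfI x0); rewrite -exprS prednK ?mulr1 ?q_gt0.
rewrite def_x -exprM xiX_eq1 mulnC dvdn_pred_sqr_q2 => dvd_i; exists (xi ^+ i./2).
rewrite -exprM; congr (_ ^+ _); rewrite muln2 -[RHS]odd_double_half.
suff -> : odd i = false by [].
by case/dvdnP: dvd_i => k ->; rewrite oddM /= q_odd andbF.
Qed.

(** Reduce the exponent i of x modulo 2 d to a remainder r; if r > d, pass to the inverse, whose
    remainder is 2 d - r. The lemma serves d = q + 1 for diagonal forms and d = q - 1 for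
    antidiagonal ones. *)
Lemma power_residue d x : (0 < d)%N -> x != 0 ->
  exists a j, [/\ a != 0, (j <= d)%N & x = a ^+ (2 * d) * xi ^+ j \/
                                       x^-1 = a ^+ (2 * d) * xi ^+ j].
Proof.
move=> d0 x0; have [i def_x] := xi_log x0; have xi0 := xi_neq0.
set r := (i %% (2 * d))%N; set k := (i %/ (2 * d))%N.
have def_i : i = (k * (2 * d) + r)%N by exact: divn_eq.
have r_lt : (r < 2 * d)%N by rewrite ltn_mod muln_gt0.
have [r_le | r_gt] := leqP r d.
  exists (xi ^+ k), r; split; rewrite ?xiX_neq0 //; left.
  by rewrite def_x def_i exprD exprM.
exists (xi ^- k.+1), (2 * d - r)%N; split; rewrite ?invr_eq0 ?xiX_neq0 //; first lia.
right; apply: (mulfI x0); rewrite divff // exprVn -exprM.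
apply: (mulfI (xiX_neq0 (k.+1 * (2 * d)))).
rewrite mulr1 mulrCA mulVKf ?xiX_neq0 // def_x -exprD; congr (_ ^+ _); nia.
Qed.

Definition level n := xi ^+ n + xi ^- n.

(** Equality of levels means (xi^i - xi^n) (xi^(i + n) - 1) = 0. If the second factor vanishes, q^2
    - 1 divides i + n, which is at most q^2 - 1; so i and n are both 0 or both (q^2 - 1) / 2. *)
Lemma level_inj i n : (i <= (q ^ 2).-1./2)%N -> (n <= (q ^ 2).-1./2)%N ->
  level i = level n -> i = n.
Proof.
move=> i_le n_le /eqP; rewrite -subr_eq0 => in_eq.
have N_gt0 := prim_order_gt0 xi_primitive.
have : (xi ^+ i - xi ^+ n) * (xi ^+ (i + n) - 1) = 0.
  suff -> : (xi ^+ i - xi ^+ n) * (xi ^+ (i + n) - 1) =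
            (level i - level n) * xi ^+ (i + n) by rewrite (eqP in_eq) mul0r.
  by rewrite /level exprD; field; rewrite !xiX_neq0.
move/eqP; rewrite mulf_eq0 !subr_eq0 xiX_eq xiX_eq1 => /orP[] {in_eq}.
  by rewrite !modn_small; [move/eqP | lia | lia].
by case/dvdnP=> [[|k]]; nia.
Qed.

(** * Normal forms *)

Definition diag_pt x : point F := pt (vec x 0 0 1).
Definition antidiag_pt x : point F := pt (vec 0 x 1 0).

(** The corner [x1] is carried along because the case where b has norm 1 uses this scaling to adjust
    the corner while fixing b. *)
Lemma antidiag_orbit_scale a b x1 : a != 0 ->
  pt (vec (a ^+ (2 * q) * x1) (a ^+ (2 * q.-1) * b) 1 0)
    \in K_orbit q (pt (vec x1 b 1 0)).
Proof.
move=> a0; have aq0 : a ^+ q != 0 by rewrite frob_eq0.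
apply: (@mem_K_orbit _ _ (mx2 a 0 0 a^-1)).
- by rewrite det_mx2; field.
- by rewrite vec_eq0 oner_eq0 !andbF.
have a2q : a ^+ (2 * q.-1) = (a ^+ q / a) ^+ 2.
  by rewrite mulnC exprM -[in RHS](prednK q_gt0) (exprS a); congr (_ ^+ 2); field.
exists (a / a ^+ q); first by rewrite mulf_neq0 ?invr_eq0.
rewrite kron_sl2_vec scale_vec exprVn !frobE a2q mulnC exprM.
by congr vec; field; rewrite ?a0 ?aq0.
Qed.

Lemma diag_orbit_scale a x : a != 0 ->
  diag_pt (a ^+ (2 * q.+1) * x) \in K_orbit q (diag_pt x).
Proof.
move=> a0; have aq0 : a ^+ q != 0 by rewrite frob_eq0.
apply: (@mem_K_orbit _ _ (mx2 a 0 0 a^-1)).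
- by rewrite det_mx2; field.
- by rewrite vec_eq0 oner_eq0 !andbF.
exists (a * a ^+ q)^-1; first by rewrite invr_eq0 mulf_neq0.
rewrite kron_sl2_vec scale_vec exprVn !frobE mulnC exprM (exprS a).
by congr vec; field; rewrite ?a0 ?aq0.
Qed.

Lemma diag_orbit_inv x : x != 0 -> diag_pt x^-1 \in K_orbit q (diag_pt x).
Proof.
move=> x0; apply: (@mem_K_orbit _ _ (mx2 0 1 (-1) 0)).
- by rewrite det_mx2; ring.
- by rewrite vec_eq0 oner_eq0 !andbF.
exists x => //; rewrite kron_sl2_vec scale_vec !frobE.
by congr vec; field.
Qed.

Lemma antidiag_orbit_inv x : x != 0 -> antidiag_pt x^-1 \in K_orbit q (antidiag_pt x).
Proof.
move=> x0; apply: (@mem_K_orbit _ _ (mx2 0 1 (-1) 0)).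
- by rewrite det_mx2; ring.
- by rewrite vec_eq0 oner_eq0 !andbF.
exists (- x); rewrite ?oppr_eq0 // kron_sl2_vec scale_vec !frobE.
by congr vec; field.
Qed.

Lemma diag_rep x : x != 0 ->
  exists2 j, (j <= q.+1)%N & diag_pt x \in K_orbit q (diag_pt (xi ^+ j)).
Proof.
move=> x0; have [a [j [a0 j_le]]] :=
  power_residue (ltn0Sn q) x0.
case=> xE; exists j => //; first by rewrite xE diag_orbit_scale.
apply: (K_orbit_trans (Y := diag_pt (xi ^+ j)) (X := diag_pt x^-1)).
  by rewrite -{1}[x]invrK diag_orbit_inv // invr_eq0.
by rewrite xE diag_orbit_scale.
Qed.

(** The scaling factor a^(2 (q - 1)) has norm 1, so x and its representative have norm 1 together.
    The last clause serves to exclude k = 0 and k = q - 1 when x does not have norm 1. *)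
Lemma antidiag_rep x : x != 0 ->
  exists k, [/\ (k <= q.-1)%N, antidiag_pt x \in K_orbit q (antidiag_pt (xi ^+ k))
    & xi ^+ k * (xi ^+ k) ^+ q = 1 -> x * x ^+ q = 1].
Proof.
have norm_scale a b : a != 0 -> b * b ^+ q = 1 ->
    a ^+ (2 * q.-1) * b * (a ^+ (2 * q.-1) * b) ^+ q = 1.
  move=> a0 b1; rewrite -exprS exprMn [in X in _ * X]exprS b1 mulr1 -exprM.
  have -> : (2 * q.-1 * q.+1 = (q ^ 2).-1 * 2)%N by move: q_gt2; nia.
  have a1 : a ^+ (q ^ 2).-1 = 1.
    apply: (mulfI a0); rewrite mulr1 -exprS prednK -?cardF ?expf_card //.
    by rewrite cardF expn_gt0 q_gt0.
  by rewrite exprM a1 expr1n.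
have scale a b : a != 0 ->
    antidiag_pt (a ^+ (2 * q.-1) * b) \in K_orbit q (antidiag_pt b).
  by move=> a0; have := antidiag_orbit_scale b 0 a0; rewrite mulr0.
have q1 : (0 < q.-1)%N by move: q_gt2; lia.
move=> x0; have [a [j [a0 j_le]]] := power_residue q1 x0.
case=> xE; exists j; split=> //; first by rewrite xE scale.
- by move=> j1; rewrite xE norm_scale.
- apply: (K_orbit_trans (X := antidiag_pt x^-1)); last by rewrite xE scale.
  by rewrite -{1}[x]invrK antidiag_orbit_inv // invr_eq0.
- by move=> j1; apply: invr_inj; rewrite invfM -exprVn xE norm_scale // invr1.
Qed.

Lemma hermitian_antidiag_rep b : b != 0 ->
  pt (vec 0 b (b ^+ q) 0) \in K_orbit q (diag_pt (- 4 / (b * b ^+ q))).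
Proof.
move=> b0; have bq0 : b ^+ q != 0 by rewrite frob_eq0.
have nz_v : vec 0 b (b ^+ q) 0 != 0 :> 'cV[F]_4 by rewrite vec_eq0 (negPf b0) andbF.
have n2 := two_neq0; have n4 : 4 != 0 :> F by rewrite -[4%N]/(2 * 2)%N natrM mulf_neq0.
have n2q : (2 : F) ^+ q = 2 by rewrite -[2]/(1 + 1) !frobE.
(* The rows of this matrix are orthogonal for the hyperbolic form, with values 2 and - b b^q / 2;
   the quotient of the second by the first, inverted, gives the same orbit data as the ratio of the
   scaled diagonal. *)
rewrite K_orbit_sym; apply: (@mem_K_orbit _ _ (mx2 1 b^-1 (- b / 2) (2^-1))) => //.
  by rewrite det_mx2; field; rewrite ?b0 ?n2.
exists (- (b * b ^+ q) / 2); first by rewrite !mulf_neq0 ?oppr_eq0 ?invr_eq0 ?mulf_neq0.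
rewrite kron_sl2_vec scale_vec !frobE !exprVn n2q.
by congr vec; field; rewrite ?b0 ?bq0 ?n2.
Qed.

Lemma rank1_normal_form v : v != 0 -> quad_form v = 0 ->
  pt v \in K_orbit q (pt (vec 1 0 0 0)) \/ pt v \in K_orbit q (ptU F).
Proof.
have e1_neq0 : vec 1 0 0 0 != 0 :> 'cV[F]_4 by rewrite vec_eq0 oner_eq0.
have e2_neq0 : vec 0 1 0 0 != 0 :> 'cV[F]_4 by rewrite vec_eq0 oner_eq0 andbF.
(* A singular matrix factors as r^(q) w^T; the left factor is written as a Frobenius image to match
   the action. *)
move=> v0 quad0; have [r1 [r2 [w1 [w2 def_v]]]] : exists r1 r2 w1 w2,
    v = vec (r1 ^+ q * w1) (r1 ^+ q * w2) (r2 ^+ q * w1) (r2 ^+ q * w2).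
  move: (vecE v) quad0; set x1 := v 0 0; set x2 := v 1 0; set x3 := v 2 0.
  set x4 := v 3 0; move=> ->; rewrite quad_form_vec => /eqP.
  rewrite subr_eq0 => /eqP E.
  have [x1_0 | x1_0] := eqVneq x1 0; last first.
    exists 1, ((x3 / x1) ^+ q), x1, x2; rewrite frobK !frobE.
    congr vec; [ring | ring | by field | ].
    by apply: (mulfI x1_0); rewrite E; field.
  have [x2_0 | x2_0] := eqVneq x2 0; last first.
    exists 1, ((x4 / x2) ^+ q), x1, x2; rewrite frobK !frobE.
    congr vec; [ring | ring | | by field].
    by apply: (mulfI x2_0); rewrite -E; field.
  exists 0, 1, x3, x4; rewrite !frobE x1_0 x2_0; congr vec; ring.
have r0 : (r1 != 0) || (r2 != 0).
  rewrite -negb_and; apply: contra v0 => /andP[/eqP r10 /eqP r20].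
  by rewrite def_v r10 r20 frobE !mul0r vec_eq0 eqxx.
have [D0 | D0] := eqVneq (r1 * w2 - r2 * w1) 0; [left | right]; last first.
  (* U is the matrix e1 e2^T, so A carries it to the product of its Frobenius-twisted first column
     and its second column. Dividing w by det (r, w) makes A unimodular. *)
  apply: (@mem_K_orbit _ _ (mx2 r1 (w1 / (r1 * w2 - r2 * w1))
                                r2 (w2 / (r1 * w2 - r2 * w1)))) => //.
    by rewrite det_mx2; field.
  exists (r1 * w2 - r2 * w1)^-1; rewrite ?invr_eq0 //.
  by rewrite def_v kron_sl2_vec scale_vec; congr vec; field.
(* If r and w are proportional, the form is a multiple of r^(q) r^T, and any unimodular A with first
   column r works. *)
have [k w1E w2E] : exists2 k, w1 = k * r1 & w2 = k * r2.
  move/eqP: D0; rewrite subr_eq0 => /eqP D0.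
  have [r1_0 | r1_0] := eqVneq r1 0.
    have r2_0 : r2 != 0 by move: r0; rewrite r1_0 eqxx.
    exists (w2 / r2); last by field.
    by apply: (mulfI r2_0); rewrite -D0 r1_0; ring.
  exists (w1 / r1); first by field.
  by apply: (mulfI r1_0); rewrite D0; field.
have k0 : k != 0.
  apply: contraNneq v0 => k0.
  by rewrite def_v w1E w2E k0 !mul0r !mulr0 vec_eq0 eqxx.
have [a12 [a22 dA]] : exists a12 a22, r1 * a22 - a12 * r2 = 1.
  have [r1_0 | r1_0] := eqVneq r1 0.
    have r2_0 : r2 != 0 by move: r0; rewrite r1_0 eqxx.
    by exists (- r2^-1), 0; field.
  by exists 0, (r1^-1); field.
apply: (@mem_K_orbit _ _ (mx2 r1 a12 r2 a22)) => //; first by rewrite det_mx2.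
exists k^-1; rewrite ?invr_eq0 //.
by rewrite def_v kron_sl2_vec scale_vec w1E w2E; congr vec; field.
Qed.

(** * Forms of rank two *)

Lemma singular_left_kernel (n1 n2 n3 n4 : F) : n1 * n4 = n2 * n3 ->
  exists z1 z2, [/\ (z1 != 0) || (z2 != 0),
    z1 * n1 + z2 * n3 = 0 & z1 * n2 + z2 * n4 = 0].
Proof.
move=> E; have [n13 | ] := boolP ((n3 != 0) || (n1 != 0)).
  exists n3, (- n1); rewrite oppr_eq0; split => //; first by ring.
  by rewrite mulNr E; ring.
rewrite negb_or !negbK => /andP[/eqP n3_0 /eqP n1_0].
have [n24 | ] := boolP ((n4 != 0) || (n2 != 0)).
  exists n4, (- n2); rewrite oppr_eq0; split => //; last by ring.
  by rewrite n1_0 n3_0; ring.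
rewrite negb_or !negbK => /andP[/eqP n4_0 /eqP n2_0].
by exists 1, 0; rewrite oner_eq0 n1_0 n2_0 n3_0 n4_0 !mulr0 addr0.
Qed.

(* The discriminant h ^ 2 - 4 d ^ (q + 1) of det (M - t M^* ) lies in F_q, hence
   it is a square in F and the pencil spanned by M and M^* has a singular
   member. *)
Lemma rank2_normal_form v : quad_form v != 0 ->
  (exists2 x, x != 0 & pt v \in K_orbit q (diag_pt x)) \/
  (exists y b, b != 0 /\ pt v \in K_orbit q (pt (vec y b 1 0))).
Proof.
move=> d0; have v0 : v != 0.
  by apply: contraNneq d0 => ->; rewrite /quad_form !mxE !mul0r subrr.
have hq : herm_form q v ^+ q = herm_form q v.
  by rewrite (vecE v) herm_form_vec !frobE; ring.
have n2 := two_neq0; have n2q : (2 : F) ^+ q = 2 by rewrite -[2]/(1 + 1) !frobE.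
have n4q : (4 : F) ^+ q = 4 by rewrite -[4%N]/(2 * 2)%N natrM !frobE.
pose d := quad_form v; pose h := herm_form q v.
have dq0 : d ^+ q != 0 by rewrite frob_eq0.
have [|s s2] := frob_fixed_sqr
  (x := h ^+ 2 - 4 * d * d ^+ q).
  by rewrite /h frobB !exprMn frobK n4q hq; ring.
pose t := (h + s) / (2 * d ^+ q).
have pencil0 : d - t * h + t ^+ 2 * d ^+ q = 0.
  have -> : d - t * h + t ^+ 2 * d ^+ q =
     (s ^+ 2 - (h ^+ 2 - 4 * d * d ^+ q)) / (4 * d ^+ q).
    rewrite /t; field; rewrite n2 dq0 andbT.
    by rewrite -[4%N]/(2 * 2)%N natrM mulf_neq0.
  by rewrite s2 subrr mul0r.
have d_def : d = quad_form v by []. have h_def : h = herm_form q v by [].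
have K0 A : \det A = 1 -> pt (kron_sl2 q A *m v) \in K_orbit q (pt v).
  by move=> dA; apply/K_orbitP => //; exists A.
have K1 A : \det A = 1 -> kron_sl2 q A *m v != 0 /\
    quad_form (kron_sl2 q A *m v) != 0.
  move=> dA; split; first by rewrite kron_sl2_neq0 ?dA ?oner_eq0.
  by rewrite quad_form_kron dA expr1n mul1r.
move: (vecE v) K0 K1 d_def h_def.
set x1 := v 0 0; set x2 := v 1 0; set x3 := v 2 0; set x4 := v 3 0.
move=> vE K0 K1; rewrite {1 2}vE quad_form_vec herm_form_vec => dE hE.
have dqE : d ^+ q = x1 ^+ q * x4 ^+ q - x2 ^+ q * x3 ^+ q by rewrite dE !frobE; ring.
have [|z1 [z2 [z0 l1 l2]]] := @singular_left_kernel
   (x1 - t * x1 ^+ q) (x2 - t * x3 ^+ q) (x3 - t * x2 ^+ q) (x4 - t * x4 ^+ q).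
  apply/eqP; rewrite -subr_eq0 -pencil0 dqE dE hE; apply/eqP; ring.
(* The left factor of the action is A^(q), so the row (a, b) of A contributes z itself there. Below,
   f = z M, and [al] is the value of the form at this row; z being in the kernel of M - t M^* gives
   f = t z M^*. *)
pose a := z1 ^+ q; pose b := z2 ^+ q.
have aqE : a ^+ q = z1 by rewrite frobK.
have bqE : b ^+ q = z2 by rewrite frobK.
pose f1 := z1 * x1 + z2 * x3; pose f2 := z1 * x2 + z2 * x4.
have f1E : f1 = t * (z1 * x1 ^+ q + z2 * x2 ^+ q).
  by apply/eqP; rewrite -subr_eq0 -l1 /f1; apply/eqP; ring.
have f2E : f2 = t * (z1 * x3 ^+ q + z2 * x4 ^+ q).
  by apply/eqP; rewrite -subr_eq0 -l2 /f2; apply/eqP; ring.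
pose al := a * f1 + b * f2.
(* An isotropic row is placed second in A, which makes the last entry of the form vanish. A
   non-isotropic one is placed first and completed by an orthogonal row. *)
have [al0 | al0] := eqVneq al 0; [right | left].
  have [c [d' dA]] : exists c d', c * b - d' * a = 1.
    have [a_0 | a_0] := eqVneq a 0.
      have b_0 : b != 0.
        rewrite frob_eq0; move: z0 a_0; rewrite /a => /orP[z1_0|//] /eqP.
        by rewrite frob_eq0 (negPf z1_0).
      by exists b^-1, 0; field.
    by exists 0, (- a^-1); field.
  have detA : \det (mx2 c d' a b) = 1 by rewrite det_mx2.
  have [] := K1 _ detA; have := K0 _ detA; rewrite vE kron_sl2_vec aqE bqE.
  have -> : z1 * (x1 * a + x2 * b) + z2 * (x3 * a + x4 * b) = 0.
    by rewrite -al0 /al /f1 /f2; ring.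
  set y1 := (X in vec X); set y2 := (X in vec _ X); set y3 := (X in vec _ _ X).
  move=> vy y_neq0; rewrite quad_form_vec mulr0 sub0r oppr_eq0 mulf_eq0 negb_or.
  case/andP=> y2_0 y3_0; exists (y1 / y3), (y2 / y3); split.
    by rewrite mulf_neq0 ?invr_eq0.
  rewrite K_orbit_sym -(pt_scale y3_0) ?vec_eq0 ?oner_eq0 ?andbF //.
  rewrite scale_vec mulr1 mulr0 ![y3 * _]mulrC !divfK //.
(* The second row is chosen orthogonal to f, which kills one off-diagonal entry. The other one is
   the q-th power of an expression in z M^*, and it vanishes because f is t times z M^*. *)
have detA : \det (mx2 a b (- f2 / al) (f1 / al)) = 1.
  rewrite det_mx2; transitivity ((a * f1 + b * f2) / al); last exact: divff.
  by field.
have t0 : t != 0.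
  by apply: contraNneq al0 => t0; rewrite /al f1E f2E t0; apply/eqP; ring.
have [] := K1 _ detA; have := K0 _ detA; rewrite vE kron_sl2_vec aqE bqE.
have -> : z1 * (x1 * (- f2 / al) + x2 * (f1 / al)) +
          z2 * (x3 * (- f2 / al) + x4 * (f1 / al)) = 0.
  by rewrite /f1 /f2; field.
have -> : (- f2 / al) ^+ q * (x1 * a + x2 * b) +
          (f1 / al) ^+ q * (x3 * a + x4 * b) = 0.
  have -> : (- f2 / al) ^+ q * (x1 * a + x2 * b) + (f1 / al) ^+ q * (x3 * a + x4 * b) =
     ((- f2 * (z1 * x1 ^+ q + z2 * x2 ^+ q) + f1 * (z1 * x3 ^+ q + z2 * x4 ^+ q)) / al) ^+ q.
    by rewrite !exprMn !frobE -/a -/b; ring.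
  suff -> : - f2 * (z1 * x1 ^+ q + z2 * x2 ^+ q) + f1 * (z1 * x3 ^+ q + z2 * x4 ^+ q) = 0.
    by rewrite mul0r frobE.
  by rewrite f1E f2E; ring.
set y1 := (X in vec X); set y4 := (X in vec _ _ _ X).
move=> vy y_neq0; rewrite quad_form_vec mulr0 subr0 mulf_eq0 negb_or.
case/andP=> y1_0 y4_0; exists (y1 / y4); first by rewrite mulf_neq0 ?invr_eq0.
rewrite K_orbit_sym /diag_pt -(pt_scale y4_0) ?vec_eq0 ?oner_eq0 ?andbF //.
by rewrite scale_vec mulr1 mulr0 [y4 * _]mulrC divfK.
Qed.

(** * Forms with an isotropic vector *)

Lemma isotropic_shift s y b :
  pt (vec (y + s ^+ q + s * b) b 1 0) \in K_orbit q (pt (vec y b 1 0)).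
Proof.
apply: (@mem_K_orbit _ _ (mx2 1 s 0 1)); first by rewrite det_mx2; ring.
  by rewrite vec_eq0 oner_eq0 !andbF.
exists 1; first exact: oner_neq0.
by rewrite kron_sl2_vec scale_vec !frobE; congr vec; ring.
Qed.

Lemma isotropic_rep_generic y b : b * b ^+ q != 1 ->
  pt (vec y b 1 0) \in K_orbit q (antidiag_pt b).
Proof.
rewrite -subr_eq0 => b1; rewrite K_orbit_sym.
(* The equation s^q + b s = - y and its conjugate are linear in s and s^q, with determinant b b^q -
   1 up to sign; this is the solution. *)
pose s := (y ^+ q - b ^+ q * y) / (b * b ^+ q - 1).
suff y0 : y + s ^+ q + s * b = 0 by have := isotropic_shift s y b; rewrite y0.
have sq : s ^+ q = (y - b * y ^+ q) / (b * b ^+ q - 1).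
  by rewrite /s exprMn exprVn !frobB exprMn exprMn !frobK expr1n [b ^+ q * b]mulrC.
by rewrite sq /s; field.
Qed.

(* The nonzero values of the F_q-linear map z |-> z ^ q * w - z lie in a single
   class modulo F_q^*, and its kernel is the set of values of s ^ q + s * w. *)
Lemma isotropic_rep_norm1 t w y : w * w ^+ q = 1 -> t ^+ q * w != t ->
  pt (vec y w 1 0) \in K_orbit q (antidiag_pt w) \/
  pt (vec y w 1 0) \in K_orbit q (pt (vec t w 1 0)).
Proof.
move=> w1 tn; have n2 := two_neq0.
have n2q : (2 : F) ^+ q = 2 by rewrite -[2]/(1 + 1) !frobE.
have w0 : w != 0 by apply: contra_eq_neq w1 => ->; rewrite mul0r eq_sym oner_neq0.
have kernel z : z ^+ q * w = z -> exists s, z = s ^+ q + s * w.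
  move=> zE; exists (z / (2 * w)); rewrite exprMn exprVn exprMn n2q.
  have wq : w ^+ q = w^-1 by apply: (mulfI w0); rewrite w1 divff.
  have zq : z ^+ q = z / w by rewrite -[in RHS]zE mulfK.
  by rewrite wq zq; field; rewrite w0 n2.
pose phi z := z ^+ q * w - z.
have phiq z : phi z ^+ q = - (w ^+ q * phi z).
  rewrite /phi frobB exprMn frobK -[in X in _ - X](mul1r (z ^+ q)) -w1; ring.
(* If phi vanishes at y, a shift clears the corner. Otherwise phi t / phi y lies in F_q and is a
   square a^2; scaling by a then multiplies y by this ratio and fixes w, after which y and t differ
   by a kernel element. *)
have [y0 | yn] := eqVneq (phi y) 0; [left | right].
  have [|s yE] := kernel (- y).
    by rewrite frobN mulNr; congr (- _); apply/eqP; rewrite -subr_eq0 -/(phi y) y0.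
  rewrite K_orbit_sym; have := isotropic_shift s y w.
  by rewrite -addrA -yE subrr.
have t0 : phi t != 0 by rewrite subr_eq0.
have lq : (phi t / phi y) ^+ q = phi t / phi y.
  rewrite exprMn exprVn !phiq invrN mulrNN invfM mulrACA divff ?mul1r //.
  by rewrite frob_eq0.
have [a a2] := frob_fixed_sqr lq.
have a0 : a != 0.
  by rewrite -sqrf_eq0 a2 mulf_neq0 ?invr_eq0.
have al : a ^+ (2 * q) = phi t / phi y by rewrite exprM a2 lq.
have a1 : a ^+ (2 * q.-1) = 1.
  have l0 : phi t / phi y != 0 by rewrite mulf_neq0 ?invr_eq0.
  rewrite exprM a2; apply: (mulfI l0); by rewrite -exprS prednK ?q_gt0 // lq mulr1.
have yl := antidiag_orbit_scale w y a0; rewrite a1 al mul1r K_orbit_sym in yl.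
apply: K_orbit_trans yl _.
set y' := _ / _ * y; rewrite K_orbit_sym.
have [|s tE] := kernel (t - y').
  apply/eqP; rewrite -subr_eq0 -/(phi _); apply/eqP.
  rewrite /phi /y' frobB exprMn lq; transitivity (phi t - phi t / phi y * phi y).
    by rewrite /phi; ring.
  by rewrite divfK ?subrr.
have := isotropic_shift s y' w.
by rewrite -addrA -tE [y' + _]addrC subrK.
Qed.

Lemma xi_norm i : xi ^+ i * (xi ^+ i) ^+ q = xi ^+ (q.+1 * i).
Proof. by rewrite -exprS -exprM mulnC. Qed.

(** An element of norm 1 is xi^((q - 1) k), and the parity of k decides whether it is a 2 (q - 1)-th
    power or xi^(q - 1) times one. *)
Lemma norm1_residue b : b * b ^+ q = 1 ->
  exists a w, [/\ a != 0, w = 1 \/ w = xi ^+ q.-1 & b = a ^+ (2 * q.-1) * w].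
Proof.
move=> b1; have b0 : b != 0.
  by apply: contra_eq_neq b1 => ->; rewrite mul0r eq_sym oner_neq0.
have [i bE] := xi_log b0; move/eqP: b1.
rewrite bE xi_norm xiX_eq1 dvdn_pred_sqr_q1 => /dvdnP[k iE].
exists (xi ^+ k./2), (xi ^+ (q.-1 * odd k)); split; first exact: xiX_neq0.
  by case: (odd k); [right; rewrite muln1 | left; rewrite muln0].
rewrite -exprM -exprD; congr (_ ^+ _); rewrite iE -[k in LHS]odd_double_half; lia.
Qed.

(** If b does not have norm 1 the form becomes antidiagonal. Otherwise b reduces to w = 1 or w =
    xi^(q - 1); the corner is then cleared, leaving a Hermitian form up to a scalar, or becomes t,
    with t = xi giving T1 for the first w and t = w giving T2 for the second. *)
Lemma isotropic_rep y b : b != 0 ->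
  let X := pt (vec y b 1 0) in
  [\/ exists2 j, (j <= q.+1)%N & X \in K_orbit q (diag_pt (xi ^+ j)),
      exists2 k, (0 < k < q.-1)%N & X \in K_orbit q (antidiag_pt (xi ^+ k)),
      X \in K_orbit q (ptT1 xi) |  X \in K_orbit q (ptT2 q xi)].
Proof.
move=> b0 X; have x0 := xi_neq0; have xn := xiX_neq0.
have [b1 | bn1] := eqVneq (b * b ^+ q) 1; last first.
  have [k [k_le Xk k1]] := antidiag_rep b0.
  have XK := K_orbit_trans (isotropic_rep_generic y bn1) Xk.
  constructor 2; exists k => //; rewrite lt0n [(k < _)%N]ltn_neqAle k_le andbT.
  apply/andP; split; apply: contra_neq bn1 => kE; apply: k1; apply/eqP;
    by rewrite xi_norm xiX_eq1 dvdn_pred_sqr_q1 kE.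
have herm c : c != 0 -> exists2 j, (j <= q.+1)%N &
    pt (vec 0 c (c ^+ q) 0) \in K_orbit q (diag_pt (xi ^+ j)).
  move=> c0; have [|j j_le j_rep] := diag_rep (x := - 4 / (c * c ^+ q)).
    rewrite mulf_neq0 ?invr_eq0 ?mulf_neq0 ?frob_eq0 // oppr_eq0.
    by rewrite -[4%N]/(2 * 2)%N natrM mulf_neq0 ?two_neq0.
  by exists j => //; apply: K_orbit_trans (hermitian_antidiag_rep c0) j_rep.
have [a [w [a0 w_cases bE]]] := norm1_residue b1.
have Xw : X \in K_orbit q (pt (vec (y / a ^+ (2 * q)) w 1 0)).
  have := antidiag_orbit_scale w (y / a ^+ (2 * q)) a0.
  by rewrite -bE [_ * (y / _)]mulrC divfK ?expf_neq0.
have N_ndvd i : (0 < i < (q ^ 2).-1)%N -> xi ^+ i != 1.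
  by case/andP=> i0 iN; rewrite xiX_eq1 gtnNdvd.
case: w_cases Xw {bE} => -> Xw {w}.
  have [||Xa|Xt] := @isotropic_rep_norm1 xi 1 (y / a ^+ (2 * q)).
  - by rewrite expr1n mulr1.
  - rewrite mulr1 -(inj_eq (mulIf (invr_neq0 x0))) divff //.
    rewrite -[q]prednK ?q_gt0 // exprSr mulfK // N_ndvd //.
    by have := m_gt0; rewrite pred_q pred_sqr_q; nia.
  - have [|j j_le j_rep] := herm 1; first exact: oner_neq0.
    constructor 1; exists j => //; apply: K_orbit_trans Xw _.
    by apply: K_orbit_trans Xa _; rewrite expr1n in j_rep.
  - by constructor 3; apply: K_orbit_trans Xw Xt.
set w := xi ^+ q.-1 in Xw; have w1 : w * w ^+ q = 1.
  by rewrite xi_norm; apply/eqP; rewrite xiX_eq1 dvdn_pred_sqr_q1.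
have [//||Xa|Xt] := @isotropic_rep_norm1 w w (y / a ^+ (2 * q)).
- rewrite mulrC w1 eq_sym N_ndvd //.
  by have := m_gt0; rewrite pred_q pred_sqr_q; nia.
(* Multiplying (0, xi^(q - 1), 1, 0) by xi gives (0, xi^q, xi, 0), which is Hermitian. *)
- have [|j j_le j_rep] := herm (xi ^+ q); first exact: xn.
  constructor 1; exists j => //; apply: K_orbit_trans Xw _.
  apply: K_orbit_trans Xa _; rewrite frobK in j_rep.
  rewrite -[antidiag_pt w](pt_scale x0) ?vec_eq0 ?oner_eq0 ?andbF //.
  by rewrite scale_vec mulr0 mulr1 -exprS prednK ?q_gt0.
- by constructor 4; apply: K_orbit_trans Xw Xt.
Qed.

Lemma nonquadric_rep P : P \notin quadric F ->
  [\/ exists2 j, (j <= q.+1)%N & P \in K_orbit q (diag_pt (xi ^+ j)),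
      exists2 k, (0 < k < q.-1)%N & P \in K_orbit q (antidiag_pt (xi ^+ k)),
      P \in K_orbit q (ptT1 xi) |  P \in K_orbit q (ptT2 q xi)].
Proof.
have [v v0 ->] := pt_surj P; rewrite mem_quadric // => quad0.
have [[x x0 Px] | [y [b [b0 Pb]]]] := rank2_normal_form quad0.
  have [j j_le Xj] := diag_rep x0.
  by constructor 1; exists j => //; apply: K_orbit_trans Px Xj.
have [[j j_le Xj] | [k k_lt Xk] | X1 | X2] := isotropic_rep y b0.
- by constructor 1; exists j => //; apply: K_orbit_trans Pb Xj.
- by constructor 2; exists k => //; apply: K_orbit_trans Pb Xk.
- by constructor 3; apply: K_orbit_trans Pb X1.
- by constructor 4; apply: K_orbit_trans Pb X2.
Qed.

(** * Levels of the representatives *)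

Definition surf n : {set point F} := locus (pencil_form q (level n)).

(** As xi^((q - 1) (q + 1) / 2) = -1, replacing k by q - 1 - k changes the sign of gamma. *)
Definition kE k := if (q %% 4 == 1)%N then k else (q.-1 - k)%N.

Definition T0 := if (q %% 4 == 1)%N then ptT1 xi else ptT2 q xi.
Definition Tlast := if (q %% 4 == 1)%N then ptT2 q xi else ptT1 xi.

Lemma surfS_level j : surfS q xi j = surf (j * m).
Proof. by rewrite /surfS half_pred_q. Qed.

Lemma surfE_level k : surfE q xi k = surf (k * m.+1).
Proof. by rewrite /surfE half_succ_q. Qed.

(** Where d is nonzero, gamma is the quotient h / d^((q + 1) / 2). *)
Lemma surf_inj P n n' : P \notin quadric F ->
    (n <= 2 * m * m.+1)%N -> (n' <= 2 * m * m.+1)%N ->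
  P \in surf n -> P \in surf n' -> n = n'.
Proof.
have [v v0 ->] := pt_surj P; rewrite mem_quadric // => quad0 n_le n'_le.
rewrite !mem_pencil // => /eqP-> /eqP/(mulIf (expf_neq0 _ quad0)) E.
by apply: level_inj E; rewrite half_pred_sqr_q.
Qed.

Lemma K_orbit_surf P X n : P \in K_orbit q X -> (P \in surf n) = (X \in surf n).
Proof. exact: K_orbit_pencil. Qed.

Lemma xi_norm_q i : (xi ^+ i) ^+ q = xi ^+ (2 * m * i) * xi ^+ i.
Proof. by rewrite -exprM -exprD; congr (_ ^+ _); have := q_half; nia. Qed.

Lemma xi_minus1 : xi ^+ (2 * m * m.+1) = -1.
Proof. by rewrite -half_pred_sqr_q xi_half. Qed.

Lemma ptR_nonquadric j : ptR xi j \notin quadric F.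
Proof.
rewrite mem_quadric ?vec_eq0 ?oner_eq0 ?andbF // quad_form_vec.
by rewrite mulr1 mulr0 subr0 xiX_neq0.
Qed.

Lemma ptQ_nonquadric k : ptQ xi k \notin quadric F.
Proof.
rewrite mem_quadric ?vec_eq0 ?oner_eq0 ?andbF // quad_form_vec.
by rewrite mulr1 mulr0 sub0r oppr_eq0 xiX_neq0.
Qed.

Lemma ptT1_nonquadric : ptT1 xi \notin quadric F.
Proof.
rewrite mem_quadric ?vec_eq0 ?oner_eq0 ?andbF // quad_form_vec.
by rewrite mulr1 mulr0 sub0r oppr_eq0 oner_eq0.
Qed.

Lemma ptT2_nonquadric : ptT2 q xi \notin quadric F.
Proof.
rewrite mem_quadric ?vec_eq0 ?oner_eq0 ?andbF // quad_form_vec.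
by rewrite mulr1 mulr0 sub0r oppr_eq0 xiX_neq0.
Qed.

(** With x = xi^j, h = x^q + x and d = x, so h / d^((q + 1) / 2) = x^((q - 1) / 2) + x^(-(q - 1) /
    2). *)
Lemma ptR_surf j : ptR xi j \in surf (j * m).
Proof.
rewrite mem_pencil ?vec_eq0 ?oner_eq0 ?andbF // herm_form_vec quad_form_vec.
rewrite half_succ_q frob0 expr1n !mulr1 !mulr0 !subr0 xi_norm_q /level exprS -/m.
have -> : (2 * m * j = j * m * 2)%N by lia.
rewrite [xi ^+ (_ * 2)]exprM -[_ ^+ m]exprM; apply/eqP; field.
by rewrite xiX_neq0.
Qed.

Lemma sign_half_succ : (-1) ^+ m.+1 = (if odd m then 1 else -1) :> F.
Proof. by rewrite -signr_odd /=; case: (odd m). Qed.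

(** With x = xi^k, h = -(x^(q + 1) + 1) and d = - x, so the quotient is (-1)^m (x^((q + 1) / 2) +
    x^(-(q + 1) / 2)). For odd m the sign is absorbed by [kE]. *)
Lemma ptQ_surf k : (k <= q.-1)%N -> ptQ xi k \in surf (kE k * m.+1).
Proof.
move=> k_le; rewrite mem_pencil ?vec_eq0 ?oner_eq0 ?andbF // herm_form_vec.
rewrite quad_form_vec half_succ_q frob0 expr1n -/m xi_norm.
rewrite !mulr1 !mul0r !sub0r add0r.
have -> : (q.+1 * k = k * m.+1 * 2)%N by have := q_half; rewrite -/m; lia.
rewrite exprNn sign_half_succ [xi ^+ (_ * 2)]exprM -[_ ^+ k ^+ _]exprM.
have u0 := xiX_neq0 (k * m.+1).
rewrite /kE mod4E -/m; have [m_odd | m_even] := boolP (odd m); rewrite /level.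
  have -> : xi ^+ ((q.-1 - k) * m.+1) = - (xi ^+ (k * m.+1))^-1.
    apply: (mulIf u0); rewrite mulNr mulVf // -exprD -mulnDl subnK //.
    by rewrite pred_q -/m xi_minus1.
  by apply/eqP; field; rewrite u0 oppr_eq0 oner_eq0.
by rewrite /=; apply/eqP; field.
Qed.

Lemma level0 : level 0 = 2.
Proof. by rewrite /level expr0 invr1. Qed.

Lemma level_last : level (2 * m * m.+1) = - 2.
Proof. by rewrite /level xi_minus1 invrN1 -opprD. Qed.

Lemma ptT1_surf : ptT1 xi \in surf (if odd m then 2 * m * m.+1 else 0).
Proof.
rewrite mem_pencil ?vec_eq0 ?oner_eq0 ?andbF // herm_form_vec quad_form_vec.
rewrite half_succ_q -/m frob0 expr1n !mulr0 mulr1 add0r !sub0r.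
rewrite ?sign_half_succ; case: (odd m); rewrite ?level0 ?level_last; apply/eqP; ring.
Qed.

Lemma ptT2_surf : ptT2 q xi \in surf (if odd m then 0 else 2 * m * m.+1).
Proof.
rewrite mem_pencil ?vec_eq0 ?oner_eq0 ?andbF // herm_form_vec quad_form_vec.
rewrite half_succ_q -/m frob0 expr1n !mulr0 !mulr1 add0r !sub0r xi_norm.
have -> : xi ^+ (q.+1 * q.-1) = 1.
  by apply/eqP; rewrite xiX_eq1 dvdn_pred_sqr_q1.
rewrite exprNn -exprM pred_q -/m xi_minus1.
rewrite ?sign_half_succ; case: (odd m); rewrite ?level0 ?level_last; apply/eqP; ring.
Qed.

Lemma T0_surf : T0 \in surf 0.
Proof.
rewrite /T0 mod4E -/m; have := ptT1_surf; have := ptT2_surf.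
by case: (odd m).
Qed.

Lemma Tlast_surf : Tlast \in surf (2 * m * m.+1).
Proof.
rewrite /Tlast mod4E -/m; have := ptT1_surf; have := ptT2_surf.
by case: (odd m).
Qed.

Lemma T0_nonquadric : T0 \notin quadric F.
Proof. by rewrite /T0; case: ifP; rewrite ?ptT1_nonquadric ?ptT2_nonquadric. Qed.

Lemma Tlast_nonquadric : Tlast \notin quadric F.
Proof. by rewrite /Tlast; case: ifP; rewrite ?ptT1_nonquadric ?ptT2_nonquadric. Qed.

Lemma ptS1_nonquadric : ptS1 F \notin quadric F.
Proof.
rewrite mem_quadric ?vec_eq0 ?oner_eq0 ?andbF // quad_form_vec.
by rewrite mulr1 mulr0 subr0 oner_eq0.
Qed.

Lemma ptS2_nonquadric : ptS2 q xi \notin quadric F.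
Proof.
rewrite mem_quadric ?vec_eq0 ?oner_eq0 ?andbF // quad_form_vec.
by rewrite mul1r mulr0 subr0 xiX_neq0.
Qed.

Lemma ptS1_surf : ptS1 F \in surf 0.
Proof.
rewrite mem_pencil ?vec_eq0 ?oner_eq0 ?andbF // herm_form_vec quad_form_vec.
rewrite level0 !mul0r !expr1n !mulr1 !subr0 expr1n; apply/eqP; ring.
Qed.

Lemma xi_succq_fixed : (xi ^+ q.+1) ^+ q = xi ^+ q.+1.
Proof.
apply/eqP; rewrite -exprM xiX_eq eqn_mod_dvd; last by rewrite leq_pmulr ?q_gt0.
by rewrite -[X in (_ - X)%N]muln1 -mulnBr dvdn_pred_sqr_q1 subn1.
Qed.

Lemma ptS2_surf : ptS2 q xi \in surf (2 * m * m.+1).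
Proof.
rewrite mem_pencil ?vec_eq0 ?oner_eq0 ?andbF // herm_form_vec quad_form_vec.
rewrite level_last half_succ_q -/m !mul0r !expr1n !subr0 !mul1r.
rewrite xi_succq_fixed [_ ^+ m.+1]exprS.
have -> : (xi ^+ q.+1) ^+ m = -1.
  by rewrite -exprM -xi_minus1; congr (_ ^+ _); have := q_half; rewrite -/m; lia.
apply/eqP; ring.
Qed.

Lemma ptR_notin_baer j : (0 < j < q.+1)%N -> ptR xi j \notin baer F q.
Proof.
case/andP=> j0 jq; apply/negP => /baer_vec[|+ _ _].
  by rewrite vec_eq0 oner_eq0 !andbF.
rewrite expr1n !mulr1 xi_norm_q -[RHS]mul1r => /(mulIf (xiX_neq0 _))/eqP.
by rewrite xiX_eq1 -pred_q dvdn_pred_sqr_q2 gtnNdvd.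
Qed.

Lemma ptQ_notin_baer k : (0 < k < q.-1)%N -> ptQ xi k \notin baer F q.
Proof.
case/andP=> k0 kq; apply/negP => /baer_vec[|_ + _].
  by rewrite vec_eq0 oner_eq0 !andbF.
by rewrite expr1n mulr1 xi_norm => /eqP; rewrite xiX_eq1 dvdn_pred_sqr_q1 gtnNdvd.
Qed.

Lemma xi_pred_q_neq1 : xi ^+ q.-1 != 1.
Proof.
rewrite xiX_eq1 gtnNdvd //; have := m_gt0; rewrite -/m => m0.
  by rewrite pred_q -/m; lia.
by rewrite pred_q pred_sqr_q -/m; nia.
Qed.

Lemma ptT1_notin_baer : ptT1 xi \notin baer F q.
Proof.
apply/negP => /baer_vec[|_ _ +].
  by rewrite vec_eq0 oner_eq0 !andbF.
rewrite expr1n mulr1 mul1r -{1}[q]prednK ?q_gt0 // exprSr -[RHS]mul1r.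
by move/(mulIf xi_neq0)/eqP; rewrite (negPf xi_pred_q_neq1).
Qed.

Lemma ptT2_notin_baer : ptT2 q xi \notin baer F q.
Proof.
apply/negP => /baer_vec[|_ _ +].
  by rewrite vec_eq0 oner_eq0 !andbF.
have w0 := expf_neq0 q (xiX_neq0 q.-1).
by move/(mulfI w0)/esym/eqP; rewrite (negPf xi_pred_q_neq1).
Qed.

Lemma ptU_notin_baer : ptU F \notin baer F q.
Proof.
apply/negP => /baer_vec[|_ + _].
  by rewrite vec_eq0 oner_eq0 !andbF.
by rewrite frob0 expr1n mulr1 mulr0 => /eqP; rewrite oner_eq0.
Qed.

Lemma ptS1_baer : ptS1 F \in baer F q.
Proof.
apply/baerP; exists 1, 0, 1; rewrite expr1n frob0 vec_eq0 oner_eq0; by split.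
Qed.

Lemma ptS2_baer : ptS2 q xi \in baer F q.
Proof.
apply/baerP; exists 1, 0, (xi ^+ q.+1).
by rewrite xi_succq_fixed expr1n frob0 vec_eq0 oner_eq0.
Qed.

Lemma T0_notin_baer : T0 \notin baer F q.
Proof. by rewrite /T0; case: ifP; rewrite ?ptT1_notin_baer ?ptT2_notin_baer. Qed.

Lemma Tlast_notin_baer : Tlast \notin baer F q.
Proof. by rewrite /Tlast; case: ifP; rewrite ?ptT1_notin_baer ?ptT2_notin_baer. Qed.

Lemma nonquadric_normal_form P : P \notin quadric F ->
  [\/ P \in Sigma1 F q \/ P \in Sigma2 q xi,
      exists2 j, (0 < j < q.+1)%N & P \in K_orbit q (ptR xi j),
      exists2 k, (0 < k < q.-1)%N & P \in K_orbit q (ptQ xi k)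
    | P \in K_orbit q T0 \/ P \in K_orbit q Tlast].
Proof.
move=> /nonquadric_rep[[j j_le Pj] | Pk | P1 | P2].
- have [j0 | j0] := posnP j.
    by constructor 1; left; move: Pj; rewrite j0.
  move: j_le; rewrite leq_eqVlt => /predU1P[jq | jq].
    (* S2 is the diagonal point of parameter xi^-(q + 1), the inverse of the one found. *)
    constructor 1; right; apply: K_orbit_trans Pj _; rewrite jq /Sigma2 /ptS2.
    have := diag_orbit_inv (xiX_neq0 q.+1).
    rewrite K_orbit_sym -[diag_pt _^-1](pt_scale (xiX_neq0 q.+1)).
      by rewrite scale_vec !mulr0 mulr1 divff ?xiX_neq0.
    by rewrite vec_eq0 oner_eq0 !andbF.
  by constructor 2; exists j; rewrite ?j0.
- by constructor 3.
- by constructor 4; rewrite /T0 /Tlast; case: ifP; [left | right].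
- by constructor 4; rewrite /T0 /Tlast; case: ifP; [right | left].
Qed.

(** * Surfaces as orbits *)

Lemma kE_range k : (0 < k < q.-1)%N -> (0 < kE k < q.-1)%N.
Proof. by rewrite /kE; case: ifP; lia. Qed.

Lemma kE_inj k k' : (k < q.-1)%N -> (k' < q.-1)%N -> kE k = kE k' -> k = k'.
Proof. by rewrite /kE; case: ifP; lia. Qed.

Lemma kE_half : kE m = m.
Proof. by rewrite /kE; case: ifP => // _; have := pred_q; rewrite -/m; lia. Qed.

Lemma last_level_gt0 : (0 < 2 * m * m.+1)%N.
Proof. by rewrite !muln_gt0 m_gt0. Qed.

Lemma level_R_range j : (0 < j < q.+1)%N -> (0 < j * m < 2 * m * m.+1)%N.
Proof. by rewrite q_half; apply: mul_half_range; exact: m_gt0. Qed.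

Lemma level_E_range k : (0 < k < q.-1)%N -> (0 < k * m.+1 < 2 * m * m.+1)%N.
Proof. by rewrite pred_q; apply: mul_half_succ_range. Qed.

Lemma level_R_E j k : (0 < j < q.+1)%N -> (0 < k < q.-1)%N ->
  (j * m)%N = (k * m.+1)%N -> j = m.+1 /\ k = m.
Proof. by rewrite pred_q [X in (_ < X.+1)%N]q_half; apply: mul_half_meet; exact: m_gt0. Qed.

(** The normal form gives a representative, and uniqueness of the level identifies n with its level.
    The descriptions of surfaces as orbits below discard the entries of any other level. *)
Lemma surf_orbit P n : (n <= 2 * m * m.+1)%N -> P \notin quadric F -> P \in surf n ->
  [\/ n = 0%N /\ (P \in Sigma1 F q \/ P \in K_orbit q T0),
      n = (2 * m * m.+1)%N /\ (P \in Sigma2 q xi \/ P \in K_orbit q Tlast),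
      exists j, [/\ (0 < j < q.+1)%N, n = (j * m)%N & P \in K_orbit q (ptR xi j)]
    | exists k, [/\ (0 < k < q.-1)%N, n = (kE k * m.+1)%N & P \in K_orbit q (ptQ xi k)]].
Proof.
move=> n_le nqP Pn.
have lvl X n' : P \in K_orbit q X -> (n' <= 2 * m * m.+1)%N -> X \in surf n' -> n = n'.
  by move=> PX n'_le; rewrite -(K_orbit_surf _ PX); apply: surf_inj.
have [[P1|P2]|[j j_lt Pj]|[k k_lt Pk]|[P1|P2]] := nonquadric_normal_form nqP.
- constructor 1; split; last by left.
  exact: lvl P1 _ ptS1_surf.
- constructor 2; split; last by left.
  exact: lvl P2 _ ptS2_surf.
- constructor 3; exists j; split=> //; apply: lvl Pj _ (ptR_surf j).
  by case/andP: (level_R_range j_lt) => _ /ltnW.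
- constructor 4; exists k; split=> //; apply: lvl Pk _ (ptQ_surf _).
    by case/andP: (level_E_range (kE_range k_lt)) => _ /ltnW.
  by case/andP: k_lt => _ /ltnW.
- constructor 1; split; last by right.
  exact: lvl P1 _ T0_surf.
- constructor 2; split; last by right.
  exact: lvl P2 _ Tlast_surf.
Qed.

Lemma level_R_inj j j' : (j * m)%N = (j' * m)%N -> j = j'.
Proof. by move/eqP; rewrite eqn_pmul2r ?m_gt0 // => /eqP. Qed.

Lemma ovoid_quadric P : P \in ovoid F q -> P \in quadric F.
Proof.
rewrite ovoidE => /K_orbit_quadric->.
by rewrite mem_quadric ?vec_eq0 ?oner_eq0 // quad_form_vec mulr0 mul0r subrr.
Qed.

Lemma ovoid_surf n P : P \in ovoid F q -> P \in surf n.
Proof.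
rewrite ovoidE => /K_orbit_surf->.
rewrite mem_pencil ?vec_eq0 ?oner_eq0 // quad_form_vec herm_form_vec half_succ_q.
by rewrite !mulr0 !mul0r !subr0 frob0 mulr0 addr0 expr0n mulr0.
Qed.

Lemma ovoid_baer P : P \in ovoid F q -> P \in baer F q.
Proof.
rewrite ovoidE => /K_orbit_baer->; apply/baerP; exists 1, 0, 0.
by rewrite frob0 expr1n vec_eq0 oner_eq0.
Qed.

Lemma quadric_orbits P : P \in quadric F -> P \in ovoid F q \/ P \in K_orbit q (ptU F).
Proof.
have [v v0 ->] := pt_surj P; rewrite mem_quadric // ovoidE => /eqP.
exact: rank1_normal_form.
Qed.

Lemma ptU_quadric : ptU F \in quadric F.
Proof.
by rewrite mem_quadric ?vec_eq0 ?oner_eq0 ?andbF // quad_form_vec !mulr0 subrr.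
Qed.

Lemma ptU_notin_surf n : ptU F \notin surf n.
Proof.
rewrite mem_pencil ?vec_eq0 ?oner_eq0 ?andbF // quad_form_vec herm_form_vec.
rewrite half_succ_q !mulr0 !mul0r !subr0 expr0n mulr0 add0r.
by rewrite expr1n mulr1 sub0r oppr_eq0 oner_eq0.
Qed.

(** On the quadric the equation of the surface becomes h = 0, which fails at U. Thus every surface
    of the pencil meets the quadric exactly in O. *)
Lemma quadric_surf n P : P \in surf n -> (P \in quadric F) = (P \in ovoid F q).
Proof.
move=> Pn; apply/idP/idP; last exact: ovoid_quadric.
case/quadric_orbits => // PU; move: Pn.
by rewrite (K_orbit_surf _ PU) (negPf (ptU_notin_surf n)).
Qed.

Lemma surf_setD_ovoid n P :
  (P \in surf n :\: ovoid F q) = (P \notin quadric F) && (P \in surf n).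
Proof.
rewrite in_setD; case Pn: (P \in surf n); last by rewrite !andbF.
by rewrite (quadric_surf Pn).
Qed.

Lemma sub_surf_orbit X n : X \notin quadric F -> X \in surf n ->
  K_orbit q X \subset surf n :\: ovoid F q.
Proof.
move=> nqX Xn; apply/subsetP=> P PX.
by rewrite surf_setD_ovoid (K_orbit_surf _ PX) (K_orbit_quadric PX) nqX Xn.
Qed.

Lemma surfS_orbit j : (0 < j < q.+1)%N -> j != m.+1 ->
  surfS q xi j :\: ovoid F q = K_orbit q (ptR xi j).
Proof.
move=> j_lt jm; rewrite surfS_level; apply/eqP; rewrite eqEsubset andbC.
rewrite sub_surf_orbit ?ptR_nonquadric ?ptR_surf //=; apply/subsetP=> P.
rewrite surf_setD_ovoid => /andP[nqP Pj]; have j_rg := level_R_range j_lt.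
have [|[n0 _]|[nl _]|[j' [_ /level_R_inj-> //]]|[k [k_lt E _]]] := surf_orbit _ nqP Pj.
- by case/andP: j_rg => _ /ltnW.
- by move: j_rg; rewrite n0.
- by move: j_rg; rewrite nl ltnn andbF.
by have [jE _] := level_R_E j_lt (kE_range k_lt) E; rewrite jE eqxx in jm.
Qed.

Lemma surfE_orbit k : (0 < k < q.-1)%N -> k != m ->
  surfE q xi (kE k) :\: ovoid F q = K_orbit q (ptQ xi k).
Proof.
move=> k_lt km; rewrite surfE_level; apply/eqP; rewrite eqEsubset andbC.
have [_ k_lt'] := andP k_lt; have k_rg := level_E_range (kE_range k_lt).
rewrite sub_surf_orbit ?ptQ_nonquadric ?ptQ_surf 1?ltnW //=; apply/subsetP=> P.
rewrite surf_setD_ovoid => /andP[nqP Pj].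
have [|[n0 _]|[nl _]|[j [j_lt E _]]|[k' [k'_lt E Pk']]] := surf_orbit _ nqP Pj.
- by case/andP: k_rg => _ /ltnW.
- by move: k_rg; rewrite n0.
- by move: k_rg; rewrite nl ltnn andbF.
- have [_ kE_m] := level_R_E j_lt (kE_range k_lt) (esym E).
  case/eqP: km; apply: kE_inj => //; last by rewrite kE_m kE_half.
  by rewrite pred_q -/m; have := m_gt0; rewrite -/m; lia.
move/eqP: E; rewrite eqn_pmul2r // => /eqP/kE_inj-> //.
by case/andP: k'_lt.
Qed.

Lemma surfE0_orbit : surfE q xi 0 :\: baer F q = K_orbit q T0.
Proof.
rewrite surfE_level mul0n; apply/setP=> P; rewrite in_setD.
apply/andP/idP => [[nbP P0] | PT]; last first.
  by rewrite (K_orbit_surf _ PT) (K_orbit_baer PT) T0_notin_baer T0_surf.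
have nqP : P \notin quadric F.
  by rewrite (quadric_surf P0); apply: contra nbP; apply: ovoid_baer.
have [//|[_ [P1|//]]|[E _]|[j [/level_R_range E n0 _]]|[k [k_lt n0 _]]] := surf_orbit _ nqP P0.
- by move: nbP; rewrite (K_orbit_baer P1) ptS1_baer.
- by have := last_level_gt0; rewrite -E.
- by rewrite -n0 in E.
- by have := level_E_range (kE_range k_lt); rewrite -n0.
Qed.

Lemma surfE_last_orbit : surfE q xi q.-1 :\: baer F q = K_orbit q Tlast.
Proof.
rewrite surfE_level pred_q -/m; apply/setP=> P; rewrite in_setD.
apply/andP/idP => [[nbP Pl] | PT]; last first.
  by rewrite (K_orbit_surf _ PT) (K_orbit_baer PT) Tlast_notin_baer Tlast_surf.
have nqP : P \notin quadric F.
  by rewrite (quadric_surf Pl); apply: contra nbP; apply: ovoid_baer.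
have [//|[E _]|[_ [P2|//]]|[j [/level_R_range E nl _]]|[k [k_lt nl _]]] := surf_orbit _ nqP Pl.
- by have := last_level_gt0; rewrite E.
- by move: nbP; rewrite (K_orbit_baer P2) ptS2_baer.
- by rewrite -nl ltnn andbF in E.
- by have := level_E_range (kE_range k_lt); rewrite -nl ltnn andbF.
Qed.

(** At this exponent xi^n is a square root of -1, so gamma = 0. *)
Lemma herm_surface_level : herm_surface F q = surf (m * m.+1).
Proof.
have l0 : level (m * m.+1) = 0.
  have u0 := xiX_neq0 (m * m.+1); have : (xi ^+ (m * m.+1)) ^+ 2 = -1.
    by rewrite -exprM -xi_minus1; congr (_ ^+ _); lia.
  move=> u2; apply: (mulfI u0); rewrite /level mulr0 mulrDr divff // -expr2 u2.
  by rewrite addNr.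
apply/setP=> P; have [v v0 ->] := pt_surj P.
by rewrite mem_herm_surface // mem_pencil // l0 mul0r.
Qed.

(** This is the one level shared by the R_j and the Q_k, whence two orbits here. *)
Lemma herm_surface_orbits :
  K_orbit q (ptR xi m.+1) :|: K_orbit q (ptQ xi m) = herm_surface F q :\: ovoid F q.
Proof.
have := q_half; have := m_gt0; rewrite -/m => m0 qE.
have m_le : (m <= q.-1)%N by rewrite pred_q leq_pmull.
have Qm : ptQ xi m \in surf (m * m.+1) by rewrite -{2}kE_half ptQ_surf.
have Rm : ptR xi m.+1 \in surf (m * m.+1) by rewrite mulnC ptR_surf.
apply/eqP; rewrite eqEsubset herm_surface_level subUset.
rewrite !sub_surf_orbit ?ptR_nonquadric ?ptQ_nonquadric //=.
apply/subsetP=> P; rewrite surf_setD_ovoid in_setU => /andP[nqP Pm].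
have [|[n0 _]|[nl _]|[j [j_lt E Pj]]|[k [k_lt E Pk]]] := surf_orbit _ nqP Pm.
- by rewrite leq_mul2r leq_pmull.
- by move/eqP: n0; rewrite muln_eq0 gtn_eqF.
- by move/eqP: nl; rewrite eqn_pmul2r // -{1}[m]mul1n eqn_pmul2r.
- by rewrite mulnC in E; rewrite (level_R_inj E) Pj.
move/eqP: E; rewrite eqn_pmul2r // -{1}kE_half => /eqP/kE_inj->; rewrite ?Pk ?orbT //.
- by rewrite pred_q -/m; lia.
- by case/andP: k_lt.
Qed.

Lemma quadric_orbit : quadric F :\: ovoid F q = K_orbit q (ptU F).
Proof.
apply/setP=> P; rewrite in_setD; apply/andP/idP => [[nO /quadric_orbits[PO|//]] | PU].
  by rewrite PO in nO.
rewrite (K_orbit_quadric PU) ptU_quadric; split=> //.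
apply/negP=> /(ovoid_surf 0); rewrite (K_orbit_surf _ PU).
by rewrite (negPf (ptU_notin_surf 0)).
Qed.

Lemma baer_orbits : Sigma1 F q :|: Sigma2 q xi = baer F q :\: ovoid F q.
Proof.
apply/setP=> P; rewrite in_setU in_setD; apply/orP/andP => [|[nO PB]].
  case=> PS; rewrite (K_orbit_baer PS) ?ptS1_baer ?ptS2_baer; split=> //.
    by apply/negP => /ovoid_quadric; rewrite (K_orbit_quadric PS) (negPf ptS1_nonquadric).
  by apply/negP => /ovoid_quadric; rewrite (K_orbit_quadric PS) (negPf ptS2_nonquadric).
have nqP : P \notin quadric F.
  apply/negP=> /quadric_orbits[PO|PU]; first by rewrite PO in nO.
  by move: PB; rewrite (K_orbit_baer PU) (negPf ptU_notin_baer).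
have [//|[j j_lt PX]|[k k_lt PX]|[PX|PX]] := nonquadric_normal_form nqP;
  move: PB; rewrite (K_orbit_baer PX).
- by rewrite (negPf (ptR_notin_baer j_lt)).
- by rewrite (negPf (ptQ_notin_baer k_lt)).
- by rewrite (negPf T0_notin_baer).
- by rewrite (negPf Tlast_notin_baer).
Qed.

(** * Orbit sizes *)

Definition sl2_set : {set 'M[F]_2} := [set A | \det A == 1].

(** Stabilisers are taken in SL(2, q^2) rather than in its image K, so they contain -1. *)
Definition sl2_stab v : {set 'M[F]_2} :=
  [set A in sl2_set | pt (kron_sl2 q A *m v) == pt v].

(** The first row u is any of the q^4 - 1 nonzero vectors. The second rows completing it to
    determinant 1 are [base u] + t u, with q^2 choices of t. *)
Lemma card_sl2_set : #|sl2_set| = ((q ^ 2) * (q ^ 4 - 1))%N.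
Proof.
pose base (u : F * F) := if u.1 == 0 then (- u.2^-1, 0) else (0, u.1^-1).
pose f (ut : F * F * F) := mx2 ut.1.1 ut.1.2
  ((base ut.1).1 + ut.2 * ut.1.1) ((base ut.1).2 + ut.2 * ut.1.2).
pose D := setX [set~ (0, 0) : F * F] [set: F].
have base_det u : u != (0, 0) -> u.1 * (base u).2 - u.2 * (base u).1 = 1.
  case: u => a b; rewrite /base xpair_eqE /=; case: (eqVneq a 0) => [-> /= b0|a0 _].
    by field.
  by rewrite /=; field.
have -> : sl2_set = f @: D.
  apply/setP=> A; apply/idP/imsetP => [|[[u t]]]; last first.
    rewrite in_setX in_setC1 in_setT andbT => /base_det du ->.
    by rewrite inE det_mx2 /=; apply/eqP; rewrite -[RHS]du; ring.
  rewrite inE (mx2E A) det_mx2; move: (A 0 0) (A 0 1) (A 1 0) (A 1 1).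
  move=> a b c d /eqP dA.
  have ab0 : (a, b) != (0, 0).
    by rewrite xpair_eqE; apply: contra_eqN dA => /andP[/eqP-> /eqP->];
       rewrite !mul0r subrr eq_sym oner_neq0.
  exists ((a, b), c * (base (a, b)).2 - d * (base (a, b)).1).
    by rewrite in_setX in_setC1 in_setT ab0.
  have /= du := base_det _ ab0; rewrite /f /=.
  move: (base (a, b)).1 (base (a, b)).2 du => r s du; congr mx2.
    transitivity (r * (a * d - b * c) + (c * s - d * r) * a); last by rewrite dA mulr1.
    transitivity (c * (a * s - b * r)); last by ring.
    by rewrite du mulr1.
  transitivity (s * (a * d - b * c) + (c * s - d * r) * b); last by rewrite dA mulr1.
  transitivity (d * (a * s - b * r)); last by ring.
  by rewrite du mulr1.
rewrite card_in_imset.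
  rewrite cardsX cardsT cardsC1 card_prod cardF mulnC; congr (_ * _)%N.
  by rewrite -expnD subn1.
case=> [[a b] t] [[a' b'] t']; rewrite in_setX in_setC1.
move=> /andP[/= ab0 _] _ /mx2_inj[/= <- <-] /=.
move=> /addrI c_eq /addrI d_eq; congr (_, _).
move: ab0; rewrite xpair_eqE negb_and => /orP[a0|b0].
  exact: (mulIf a0).
exact: (mulIf b0).
Qed.

Lemma pt_kron B v w : \det B != 0 -> v != 0 -> w != 0 ->
  pt v = pt w -> pt (kron_sl2 q B *m v) = pt (kron_sl2 q B *m w).
Proof.
move=> dB v0 w0 /eqP/eq_ptP[//|//|k k0 ->].
by rewrite -scalemxAr pt_scale ?kron_sl2_neq0.
Qed.

Lemma pt_kron_inj B v w : \det B != 0 -> v != 0 -> w != 0 ->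
  pt (kron_sl2 q B *m v) = pt (kron_sl2 q B *m w) -> pt v = pt w.
Proof.
move=> dB v0 w0 /(@pt_kron (invmx B)).
rewrite !mulmxA -kron_sl2M mulVmx ?unitmxE ?unitfE // !kron_sl2_1.
by apply; rewrite ?kron_sl2_neq0 // det_inv invr_eq0.
Qed.

(** Orbit-stabiliser for SL(2, q^2): the fibre over the image of v under B is the coset of the
    stabiliser by B. *)
Lemma card_K_orbit v : v != 0 ->
  (#|K_orbit q (pt v)| * #|sl2_stab v| = #|sl2_set|)%N.
Proof.
move=> v0; pose f A := pt (kron_sl2 q A *m v).
have -> : K_orbit q (pt v) = f @: sl2_set.
  apply/setP=> X; apply/(K_orbitP _ v0)/imsetP => [[A dA ->]|[A]].
    by exists A; rewrite // inE dA.
  by rewrite inE => /eqP dA ->; exists A.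
rewrite -[RHS]sum1_card (partition_big_imset f) /= -sum_nat_const.
apply: eq_bigr => X /imsetP[B]; rewrite inE => /eqP dB ->.
have uB : B \in unitmx by rewrite unitmxE dB unitr1.
have injB : injective (mulmx B : 'M[F]_2 -> 'M[F]_2) by apply: can_inj (mulKmx uB).
rewrite sum1_card -(card_imset (mem (sl2_stab v)) injB); apply/esym.
apply: eq_card => C; rewrite [LHS]inE; apply/andP/imsetP => [[dC /eqP CB] | [A]].
  have dA : \det (invmx B *m C) = 1.
    by move: dC; rewrite inE det_mulmx det_inv dB invr1 mul1r => /eqP.
  exists (invmx B *m C); last by rewrite mulKVmx.
  rewrite !inE dA eqxx /=; apply/eqP.
  apply: (@pt_kron_inj B); rewrite ?dB ?oner_eq0 ?kron_sl2_neq0 ?dA ?oner_eq0 //.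
  by rewrite mulmxA -kron_sl2M mulKVmx.
rewrite !inE => /andP[/eqP dA /eqP Av] ->; rewrite det_mulmx dA dB mulr1 eqxx.
split=> //; rewrite /f kron_sl2M -mulmxA; apply/eqP/pt_kron => //.
  by rewrite dB oner_eq0.
by rewrite kron_sl2_neq0 ?dA ?oner_eq0.
Qed.

Lemma sl2_stab_conj_le B v : \det B != 0 -> v != 0 ->
  (#|sl2_stab v| <= #|sl2_stab (kron_sl2 q B *m v)|)%N.
Proof.
move=> dB v0; have uB : B \in unitmx by rewrite unitmxE unitfE.
have inj_conj : injective (fun A => B *m A *m invmx B).
  apply: (can_inj (g := fun A => invmx B *m A *m B)) => A.
  by rewrite !mulmxA mulVmx // mul1mx -mulmxA mulVmx // mulmx1.
rewrite -(card_imset _ inj_conj); apply/subset_leq_card/subsetP=> C.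
case/imsetP=> A; rewrite !inE => /andP[/eqP dA /eqP Av] ->.
rewrite !det_mulmx det_inv dA mulr1 divff // eqxx /=.
rewrite !kron_sl2M -!mulmxA [kron_sl2 q (invmx B) *m _]mulmxA -kron_sl2M mulVmx //.
by rewrite kron_sl2_1; apply/eqP/pt_kron; rewrite ?kron_sl2_neq0 ?dA ?oner_eq0.
Qed.

Lemma card_sl2_stab_conj B v : \det B != 0 -> v != 0 ->
  #|sl2_stab (kron_sl2 q B *m v)| = #|sl2_stab v|.
Proof.
move=> dB v0; apply/eqP; rewrite eqn_leq sl2_stab_conj_le // andbT.
have := @sl2_stab_conj_le (invmx B) (kron_sl2 q B *m v).
rewrite mulmxA -kron_sl2M mulVmx ?kron_sl2_1 ?unitmxE ?unitfE //; apply.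
  by rewrite det_inv invr_eq0.
exact: kron_sl2_neq0.
Qed.

(** The matrix diag(1, xi), of determinant xi, carries S1 to S2, so the two stabilisers are
    conjugate in GL(2, q^2). *)
Lemma card_Sigma12 : #|Sigma1 F q| = #|Sigma2 q xi|.
Proof.
have v0 : vec 1 0 0 1 != 0 :> 'cV[F]_4 by rewrite vec_eq0 oner_eq0.
have dB : \det (mx2 1 0 0 xi) != 0 by rewrite det_mx2 mul1r mulr0 subr0 xi_neq0.
have S2E : vec 1 0 0 (xi ^+ q.+1) = kron_sl2 q (mx2 1 0 0 xi) *m vec 1 0 0 1.
  by rewrite kron_sl2_vec !frobE exprS; congr vec; ring.
have w0 : vec 1 0 0 (xi ^+ q.+1) != 0 :> 'cV[F]_4 by rewrite vec_eq0 oner_eq0.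
have := card_K_orbit v0; rewrite -(card_K_orbit w0) S2E card_sl2_stab_conj // -S2E.
move/eqP; rewrite eqn_pmul2r => [/eqP //|].
apply/card_gt0P; exists 1%:M; rewrite !inE det1 kron_sl2_1 !eqxx //.
Qed.

(** * Stabilisers on the Hermitian surface *)

Lemma card_unity_roots n : (n %| (q ^ 2).-1)%N -> #|[set x : F | x ^+ n == 1]| = n.
Proof.
move=> n_dvd; have prim_n := dvdn_prim_root xi_primitive n_dvd.
set z := xi ^+ _ in prim_n.
have inj_z : injective (fun i : 'I_n => z ^+ i).
  move=> i j /eqP; rewrite (eq_prim_root_expr prim_n) !modn_small // => /eqP.
  exact: val_inj.
rewrite -[RHS]card_ord -(card_imset _ inj_z); apply: eq_card => x; rewrite inE.
apply/eqP/imsetP => [/(prim_rootP prim_n)[i ->] | [i _ ->]]; first by exists i.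
by rewrite exprAC (prim_expr_order prim_n) expr1n.
Qed.

Lemma card_diag_stab n v : (n %| (q ^ 2).-1)%N ->
    (forall a b c d, mx2 a b c d \in sl2_stab v <->
       [/\ b = 0, c = 0, a * d = 1 & a ^+ n = 1]) ->
  #|sl2_stab v| = n.
Proof.
move=> n_dvd stabE; have n_gt0 : (0 < n)%N.
  by apply: dvdn_gt0 n_dvd; apply: prim_order_gt0 xi_primitive.
have inj_diag : injective (fun x : F => mx2 x 0 0 x^-1) by move=> x y /mx2_inj[].
rewrite -[RHS](card_unity_roots n_dvd) -[RHS](card_imset _ inj_diag).
apply: eq_card => A; apply/idP/imsetP => [|[x]].
  rewrite {1}(mx2E A) => /stabE[b0 c0 ad an]; exists (A 0 0); first by rewrite inE an.
  have a0 : A 0 0 != 0 by apply: contra_eq_neq ad => ->; rewrite mul0r eq_sym oner_eq0.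
  by rewrite [LHS]mx2E b0 c0; congr mx2; apply: (mulfI a0); rewrite ad divff.
rewrite inE => /eqP xn ->; apply/stabE; split=> //.
rewrite divff //; apply: contra_eq_neq xn => ->.
by rewrite expr0n gtn_eqF // eq_sym oner_neq0.
Qed.

(** Here x^q = - x. Conjugating one off-diagonal equation and comparing it with the other splits
    both into single products, so A is diagonal or antidiagonal. Diagonal matrices need a a^q = d
    d^q, that is a^(2 (q + 1)) = 1. *)
Lemma card_stab_R : #|sl2_stab (vec (xi ^+ m.+1) 0 0 1)| = (2 * q.+1)%N.
Proof.
set x := xi ^+ m.+1; have x0 : x != 0 := xiX_neq0 _.
have nz_v : vec x 0 0 1 != 0 :> 'cV[F]_4 by rewrite vec_eq0 oner_eq0 !andbF.
have xq : x ^+ q = - x by rewrite xi_norm_q -/m xi_minus1 mulN1r.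
have n2 := two_neq0.
have double0 y : y + y = 0 -> y = 0.
  by rewrite -mulr2n -mulr_natl => /eqP; rewrite mulf_eq0 (negPf n2) => /eqP.
apply: card_diag_stab => [|a b c d].
  have qE : q.+1 = (2 * m.+1)%N by have := q_half; rewrite -/m; lia.
  by rewrite pred_sqr_q qE -/m; apply/dvdnP; exists m; lia.
rewrite !inE det_mx2; split=> [/andP[/eqP dA] | [-> -> ad an]].
  have nz_w : kron_sl2 q (mx2 a b c d) *m vec x 0 0 1 != 0.
    by rewrite kron_sl2_neq0 ?det_mx2 ?dA ?oner_eq0.
  case/eq_ptP => // k k0; rewrite kron_sl2_vec scale_vec => /vec_inj[E1 E2 E3 E4].
  have E3q : - (a ^+ q * x * c) + b ^+ q * d = 0.
    have /(congr1 (fun y => y ^+ q)) := E3; rewrite !frobE xq => E.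
    by rewrite mulr0 in E; rewrite -E; ring.
  have ac0 : a ^+ q * x * c = 0.
    apply: double0; transitivity (a ^+ q * (x * c + 0 * d) + b ^+ q * (0 * c + 1 * d)
      - (- (a ^+ q * x * c) + b ^+ q * d)); first by ring.
    by rewrite E2 E3q mulr0 subrr.
  have bd0 : b ^+ q * d = 0.
    by move: E3q; rewrite ac0 oppr0 add0r.
  have /orP[/eqP b0|/eqP d0] : (b == 0) || (d == 0).
    by move/eqP: bd0; rewrite mulf_eq0 frob_eq0.
    have a0 : a != 0.
      by apply: contra_eq_neq dA => ->; rewrite b0 !mul0r subrr eq_sym oner_eq0.
    have c0 : c = 0.
      by apply/eqP; move/eqP: ac0; rewrite !mulf_eq0 frob_eq0 (negPf a0) (negPf x0).
    have ad : a * d = 1 by rewrite -dA b0; ring.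
    split=> //.
    have N_ad : a ^+ q * d ^+ q = 1 by rewrite -exprMn ad expr1n.
    have Ek : a * a ^+ q = k.
      by apply: (mulIf x0); rewrite -E1 b0 frob0; ring.
    have Ek' : d * d ^+ q = k by rewrite -[RHS]mulr1 -E4 c0 frob0; ring.
    by rewrite mulnC exprM (exprS a) expr2 {2}Ek -Ek' mulrACA ad N_ad mulr1.
  (* The antidiagonal case forces k = 1 or k = -1 and k x = b b^q in F_q, whereas x^q = - x. *)
  have c0 : c != 0.
    by apply: contra_eq_neq dA => ->; rewrite d0 !mulr0 subrr eq_sym oner_eq0.
  have a0 : a = 0.
    by apply/eqP; move/eqP: ac0; rewrite !mulf_eq0 frob_eq0 (negPf c0) (negPf x0) !orbF.
  have bc : b * c = -1 by apply: oppr_inj; rewrite opprK -[RHS]dA a0; ring.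
  have N_bc : b * b ^+ q * (c * c ^+ q) = 1.
    by rewrite mulrACA -exprMn bc frobN expr1n mulrNN mulr1.
  have Eb : b * b ^+ q = k * x by rewrite -E1 a0 frob0; ring.
  have Ec : x * (c * c ^+ q) = k by rewrite -[RHS]mulr1 -E4 d0 frob0; ring.
  have kq : k ^+ q = k.
    have /eqP : k ^+ 2 = 1 by rewrite expr2 -{2}Ec mulrA -Eb.
    by rewrite sqrf_eq1 => /orP[] /eqP->; rewrite ?frobN expr1n.
  have /eqP : k * x = - (k * x).
    by rewrite -[in RHS]kq -mulrN -xq -exprMn -Eb !frobE mulrC.
  by rewrite -addr_eq0 => /eqP/double0/eqP; rewrite mulf_eq0 (negPf k0) (negPf x0).
have d0 : d != 0 by apply: contra_eq_neq ad => ->; rewrite mulr0 eq_sym oner_eq0.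
have aE : a * a ^+ q = d * d ^+ q.
  have N_ad : a * a ^+ q * (d * d ^+ q) = 1.
    by rewrite mulrACA -exprMn ad expr1n mulr1.
  have u2 : a * a ^+ q * (a * a ^+ q) = 1 by rewrite -expr2 -exprS -exprM mulnC.
  transitivity (a * a ^+ q * (a * a ^+ q * (d * d ^+ q))).
    by rewrite N_ad mulr1.
  by rewrite mulrA u2 mul1r.
rewrite ad mul0r subr0 eqxx kron_sl2_vec /=; apply/eqP.
rewrite -(pt_scale (k := d * d ^+ q) _ nz_v) ?mulf_neq0 ?frob_eq0 //.
by rewrite scale_vec frob0 -{1}aE; congr (pt (vec _ _ _ _)); ring.
Qed.

(** Here x has norm -1. Taking norms shows that an isotropic row has a zero entry, so A is diagonal
    or antidiagonal. Diagonal matrices need a^q d = d^q a, that is a^(2 (q - 1)) = 1. *)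
Lemma card_stab_Q : #|sl2_stab (vec 0 (xi ^+ m) 1 0)| = (2 * q.-1)%N.
Proof.
set x := xi ^+ m; have x0 : x != 0 := xiX_neq0 _.
have nz_v : vec 0 x 1 0 != 0 :> 'cV[F]_4 by rewrite vec_eq0 oner_eq0 !andbF.
have qE : q.+1 = (2 * m.+1)%N by have := q_half; rewrite -/m; lia.
have N_x : x * x ^+ q = -1.
  by rewrite xi_norm qE -xi_minus1; congr (_ ^+ _); lia.
have n2 := two_neq0; have Nm1 : 1 != -1 :> F by rewrite -subr_eq0 opprK.
have isotropic a b : a ^+ q * (x * b) + b ^+ q * a = 0 -> (a == 0) || (b == 0).
  move/eqP; rewrite addr_eq0 => /eqP E; rewrite -implyNb; apply/implyP=> a0.
  apply: contraTT isT => b0; apply/negP => _; case/eqP: Nm1.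
  have Nab0 : (a * a ^+ q) * (b * b ^+ q) != 0 by rewrite !mulf_neq0 ?frob_eq0.
  apply: (mulfI Nab0); rewrite mulr1 -N_x.
  have := congr1 (fun y => y * y ^+ q) E; rewrite /= !frobE mulrNN => Eq.
  transitivity (b ^+ q * a * (b * a ^+ q)); first by ring.
  by rewrite -Eq; ring.
apply: card_diag_stab => [|a b c d].
  by rewrite pred_sqr_q pred_q -/m; apply/dvdnP; exists m.+1; lia.
rewrite !inE det_mx2; split=> [/andP[/eqP dA] | [-> -> ad an]].
  have nz_w : kron_sl2 q (mx2 a b c d) *m vec 0 x 1 0 != 0.
    by rewrite kron_sl2_neq0 ?det_mx2 ?dA ?oner_eq0.
  case/eq_ptP => // k k0; rewrite kron_sl2_vec scale_vec => /vec_inj[E1 E2 E3 E4].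
  have /isotropic ab0 : a ^+ q * (x * b) + b ^+ q * a = 0.
    by rewrite -[RHS](mulr0 k) -E1; ring.
  have /isotropic cd0 : c ^+ q * (x * d) + d ^+ q * c = 0.
    by rewrite -[RHS](mulr0 k) -E4; ring.
  have [b0 | b_neq0] := eqVneq b 0.
    have ad : a * d = 1 by rewrite -dA b0; ring.
    have d0 : d != 0 by apply: contra_eq_neq ad => ->; rewrite mulr0 eq_sym oner_eq0.
    have c0 : c = 0 by move: cd0; rewrite (negPf d0) orbF => /eqP.
    have Ek : a ^+ q * d = k by apply: (mulIf x0); rewrite -E2 b0 frob0; ring.
    have Ek' : d ^+ q * a = k by rewrite -[RHS]mulr1 -E3 c0 frob0; ring.
    split=> //; rewrite mulnC exprM.
    have aqE : a ^+ q = a ^+ q.-1 * a by rewrite -exprSr prednK ?q_gt0.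
    have -> : a ^+ q.-1 = k by rewrite -Ek aqE -mulrA ad mulr1.
    by rewrite expr2 -{1}Ek -Ek' mulrACA [d * a]mulrC -exprMn ad expr1n mulr1.
  have a0 : a = 0 by move: ab0; rewrite (negPf b_neq0) orbF => /eqP.
  have bc : b * c = -1 by apply: oppr_inj; rewrite opprK -[RHS]dA a0; ring.
  have c_neq0 : c != 0.
    by apply: contra_eq_neq bc => ->; rewrite mulr0 eq_sym oppr_eq0 oner_eq0.
  have d0 : d = 0 by move: cd0; rewrite (negPf c_neq0) => /eqP.
  (* In the antidiagonal case u = b^q c has norm 1, yet u^2 = x^2 gives it the norm -1 of x. *)
  have Eb : b ^+ q * c = k * x by rewrite -E2 a0 frob0; ring.
  have Ec : c ^+ q * x * b = k by rewrite -[RHS]mulr1 -E3 d0 frob0; ring.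
  have N_u : b ^+ q * c * (b ^+ q * c) ^+ q = 1.
    rewrite exprMn frobK mulrACA [b ^+ q * b]mulrC mulrACA -exprMn bc.
    by rewrite frobN expr1n mulrNN mulr1.
  have /eqP u2 : (b ^+ q * c) ^+ 2 = x ^+ 2.
    rewrite expr2 {1}Eb -{1}Ec -[RHS]mulr1 -N_u exprMn frobK; ring.
  case/eqP: Nm1; rewrite -N_x -N_u; move: u2.
  by rewrite eqf_sqr => /orP[] /eqP->; rewrite ?frobN ?mulrNN.
have d0 : d != 0 by apply: contra_eq_neq ad => ->; rewrite mulr0 eq_sym oner_eq0.
have uE : a ^+ q * d = a ^+ q.-1.
  by rewrite -[in LHS](prednK q_gt0) (exprSr a) -mulrA ad mulr1.
have aE : a ^+ q * d = d ^+ q * a.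
  have N_u : a ^+ q * d * (d ^+ q * a) = 1.
    by rewrite mulrACA -exprMn ad expr1n mul1r mulrC.
  have u2 : a ^+ q * d * (a ^+ q * d) = 1 by rewrite -expr2 uE -exprM mulnC.
  transitivity (a ^+ q * d * (a ^+ q * d * (d ^+ q * a))).
    by rewrite N_u mulr1.
  by rewrite mulrA u2 mul1r.
rewrite ad mul0r subr0 eqxx kron_sl2_vec /=; apply/eqP.
rewrite -(pt_scale (k := d ^+ q * a) _ nz_v); last first.
  rewrite -aE uE; apply: contra_eq_neq an => a0.
  by rewrite mulnC exprM a0 expr0n eq_sym oner_neq0.
rewrite scale_vec frob0; congr (pt (vec _ _ _ _)); [ring | | ring | ring].
by transitivity (a ^+ q * d * x); [ring | rewrite aE].
Qed.

Lemma card_orbit_R :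
  #|K_orbit q (ptR xi m.+1)| = (q ^ 2 * (q ^ 2 + 1) * (q - 1) %/ 2)%N.
Proof.
have nz_v : vec (xi ^+ m.+1) 0 0 1 != 0 :> 'cV[F]_4 by rewrite vec_eq0 oner_eq0 !andbF.
have := card_K_orbit nz_v; rewrite card_stab_R card_sl2_set => E.
have -> : (q ^ 2 * (q ^ 2 + 1) * (q - 1) = #|K_orbit q (ptR xi m.+1)| * 2)%N.
  apply/eqP; rewrite -(eqn_pmul2r (ltn0Sn q)) -[X in _ == X]mulnA E.
  by rewrite pred_pow4 !mulnA.
by rewrite mulnK.
Qed.

Lemma card_orbit_Q :
  #|K_orbit q (ptQ xi m)| = (q ^ 2 * (q ^ 2 + 1) * (q + 1) %/ 2)%N.
Proof.
have nz_v : vec 0 (xi ^+ m) 1 0 != 0 :> 'cV[F]_4 by rewrite vec_eq0 oner_eq0 !andbF.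
have := card_K_orbit nz_v; rewrite card_stab_Q card_sl2_set => E.
have q1 : (0 < q.-1)%N by rewrite pred_q muln_gt0 m_gt0.
have -> : (q ^ 2 * (q ^ 2 + 1) * (q + 1) = #|K_orbit q (ptQ xi m)| * 2)%N.
  apply/eqP; rewrite -(eqn_pmul2r q1) -[X in _ == X]mulnA E.
  by rewrite pred_pow4 -subn1 [(q + 1)%N]addn1 !mulnA mulnAC.
by rewrite mulnK.
Qed.

(** * The list of orbits *)

(** The order is that of the list of orbits in the theorem, so that the two lists can be matched
    entry by entry. *)
Definition reps : seq (point F) :=
  [:: pt (vec 1 0 0 0); ptS1 F; ptS2 q xi; ptU F; ptR xi m.+1; ptQ xi m]
  ++ [seq ptR xi j | j <- iota 1 q & j != m.+1]
  ++ [seq ptQ xi k | k <- iota 1 (q - 2) & k != m]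
  ++ [:: T0; Tlast].

Lemma mem_jrange j :
  (j \in [seq j <- iota 1 q | j != m.+1]) = (j != m.+1) && (0 < j < q.+1)%N.
Proof. by rewrite mem_filter mem_iota add1n. Qed.

Lemma mem_krange k :
  (k \in [seq k <- iota 1 (q - 2) | k != m]) = (k != m) && (0 < k < q.-1)%N.
Proof. by rewrite mem_filter mem_iota; congr (_ && _); have := q_gt2; lia. Qed.

Lemma half_R_range : (0 < m.+1 < q.+1)%N.
Proof. by rewrite succ_q; have := m_gt0; lia. Qed.

Lemma half_Q_range : (0 < m < q.-1)%N.
Proof. by rewrite pred_q; have := m_gt0; rewrite -/m; lia. Qed.

Lemma size_reps : size reps = (2 * q + 4)%N.
Proof.
have size_rem n i : (0 < i <= n)%N -> size [seq j <- iota 1 n | j != i] = n.-1.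
  move=> i_rg; rewrite -rem_filter ?iota_uniq // size_rem ?size_iota //.
  by rewrite mem_iota add1n ltnS.
rewrite !size_cat !size_map !size_rem /=; have := half_Q_range; have := half_R_range;
  have := q_gt2; lia.
Qed.

Lemma reps_cover P : exists2 X, X \in reps & P \in K_orbit q X.
Proof.
have [/quadric_orbits[PO | PU] | nqP] := boolP (P \in quadric F).
- by exists (pt (vec 1 0 0 0)); [exact: mem_head | rewrite -ovoidE].
- by exists (ptU F); [apply: (mem_drop (n0 := 3)); exact: mem_head | exact: PU].
have [[P1|P2]|[j j_rg PX]|[k k_rg PX]|[PT|PT]] := nonquadric_normal_form nqP.
- by exists (ptS1 F); [apply: (mem_drop (n0 := 1)); exact: mem_head | exact: P1].
- by exists (ptS2 q xi); [apply: (mem_drop (n0 := 2)); exact: mem_head | exact: P2].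
- exists (ptR xi j); last exact: PX; have [-> | jm] := eqVneq j m.+1.
    by apply: (mem_drop (n0 := 4)); exact: mem_head.
  by rewrite /reps !mem_cat [X in _ || (X || _)]map_f ?orbT // mem_jrange jm.
- exists (ptQ xi k); last exact: PX; have [-> | km] := eqVneq k m.
    by apply: (mem_drop (n0 := 5)); exact: mem_head.
  by rewrite /reps !mem_cat [X in _ || (_ || (X || _))]map_f ?orbT // mem_krange km.
- exists T0; last exact: PT; rewrite /reps !mem_cat.
  by do 3!(apply/orP; right); exact: mem_head.
- exists Tlast; last exact: PT; rewrite /reps !mem_cat.
  by do 3!(apply/orP; right); rewrite in_cons; apply/orP; right; exact: mem_head.
Qed.

(* The level is unique off the quadric, so the choice made by pick is harmless. *)
Definition orbit_key P : nat * nat :=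
  if P \in quadric F then ((P \in ovoid F q) : nat, 0%N) else
  (if [pick n : 'I_(2 * m * m.+1).+1 | P \in surf n] is Some n then val n else 0%N,
   if P \in baer F q then 1%N else (#|K_orbit q P|).+2).

Lemma orbit_key_inv P X : K_orbit q P = K_orbit q X -> orbit_key P = orbit_key X.
Proof.
move=> E; have PX : P \in K_orbit q X by apply/K_orbit_eqP.
rewrite /orbit_key (K_orbit_quadric PX) (K_orbit_baer PX) E.
have -> : (P \in ovoid F q) = (X \in ovoid F q).
  by rewrite ovoidE; apply/K_orbit_eqP/K_orbit_eqP; rewrite E.
by rewrite (eq_pick (fun n => K_orbit_surf _ PX)).
Qed.

Lemma orbit_keyE n P : P \notin quadric F -> (n <= 2 * m * m.+1)%N -> P \in surf n ->
  orbit_key P = (n, if P \in baer F q then 1%N else (#|K_orbit q P|).+2).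
Proof.
move=> nqP n_le Pn; rewrite /orbit_key (negPf nqP).
case: pickP => [i Pi | /(_ (Ordinal (n_le : (n < _.+1)%N)))]; last by rewrite /= Pn.
by congr (_, _); apply: (surf_inj nqP _ n_le Pi Pn); rewrite -ltnS; exact: ltn_ord.
Qed.

(** The keys of the representatives are pairwise distinct. Their second entry is 0 on the quadric, 1
    on Sigma and at least 2 elsewhere, which also separates S1 from T0 and S2 from Tlast. *)
Lemma uniq_orbits : uniq [seq K_orbit q X | X <- reps].
Proof.
(* The key of an orbit is read at an arbitrary point of it; the default serves the empty set
   only. *)
pose key (S : {set point F}) := orbit_key (odflt (ptU F) [pick P in S]).
have keyE X : key (K_orbit q X) = orbit_key X.
  rewrite /key; case: pickP => [P PX | /(_ X)]; last by rewrite K_orbit_refl.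
  by apply: orbit_key_inv; apply/K_orbit_eqP.
apply: (map_uniq (f := key)); rewrite -map_comp (eq_map keyE) /reps !map_cat -!map_comp.
set L := (2 * m * m.+1)%N; pose M := (m * m.+1)%N.
have [M_gt0 M_lt] : (0 < M)%N /\ (M < L)%N by have := level_E_range half_Q_range => /andP.
have key_e1 : orbit_key (pt (vec 1 0 0 0)) = (1, 0)%N.
  have e1O : pt (vec 1 0 0 0) \in ovoid F q by rewrite ovoidE K_orbit_refl.
  by rewrite /orbit_key ovoid_quadric // e1O.
have key_U : orbit_key (ptU F) = (0, 0)%N.
  rewrite /orbit_key ptU_quadric; have [/(ovoid_surf 0)|//] := boolP (_ \in ovoid F q).
  by rewrite (negPf (ptU_notin_surf 0)).
have key_S1 : orbit_key (ptS1 F) = (0, 1)%N.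
  by rewrite (orbit_keyE ptS1_nonquadric _ ptS1_surf) ?ptS1_baer.
have key_S2 : orbit_key (ptS2 q xi) = (L, 1)%N.
  by rewrite (orbit_keyE ptS2_nonquadric _ ptS2_surf) ?ptS2_baer.
have key_R j : (0 < j < q.+1)%N ->
    orbit_key (ptR xi j) = (j * m, #|K_orbit q (ptR xi j)|.+2)%N.
  move=> j_rg; have /andP[_ /ltnW j_le] := level_R_range j_rg.
  by rewrite (orbit_keyE (ptR_nonquadric j) j_le (ptR_surf j)) (negPf (ptR_notin_baer j_rg)).
have key_Q k : (0 < k < q.-1)%N ->
    orbit_key (ptQ xi k) = (kE k * m.+1, #|K_orbit q (ptQ xi k)|.+2)%N.
  move=> k_rg; have /andP[_ /ltnW k_le] := level_E_range (kE_range k_rg).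
  rewrite (orbit_keyE (ptQ_nonquadric k) k_le) ?(negPf (ptQ_notin_baer k_rg)) //.
  by apply: ptQ_surf; case/andP: k_rg => _ /ltnW.
have key_T0 : orbit_key T0 = (0, #|K_orbit q T0|.+2)%N.
  by rewrite (orbit_keyE T0_nonquadric _ T0_surf) ?(negPf T0_notin_baer).
have key_Tl : orbit_key Tlast = (L, #|K_orbit q Tlast|.+2)%N.
  by rewrite (orbit_keyE Tlast_nonquadric _ Tlast_surf) ?(negPf Tlast_notin_baer).
(* The two orbits on the Hermitian surface share their level and are told apart by size alone: the
   sizes differ by N. *)
have card_RQ : #|K_orbit q (ptR xi m.+1)| != #|K_orbit q (ptQ xi m)|.
  rewrite card_orbit_R card_orbit_Q; set N := (q ^ 2 * _)%N.
  have N_gt0 : (0 < N)%N by rewrite muln_gt0 expn_gt0 q_gt0 addn1.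
  have -> : (N * (q + 1) = N * 2 + N * (q - 1))%N.
    by rewrite -mulnDr; congr (_ * _)%N; have := q_gt0; lia.
  by rewrite divnMDl // -[X in X != _]add0n eqn_add2r eq_sym -lt0n.
have -> : [seq orbit_key X | X <-
    [:: pt (vec 1 0 0 0); ptS1 F; ptS2 q xi; ptU F; ptR xi m.+1; ptQ xi m]] =
    [:: (1, 0); (0, 1); (L, 1); (0, 0); (M, #|K_orbit q (ptR xi m.+1)|.+2);
        (M, #|K_orbit q (ptQ xi m)|.+2)]%N.
  rewrite /= key_e1 key_U key_S1 key_S2 (key_R _ half_R_range) (key_Q _ half_Q_range).
  by rewrite kE_half [(m.+1 * m)%N]mulnC.
have -> : [seq orbit_key X | X <- [:: T0; Tlast]] =
    [:: (0, #|K_orbit q T0|.+2); (L, #|K_orbit q Tlast|.+2)]%N.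
  by rewrite /= key_T0 key_Tl.
move: card_RQ (#|K_orbit q T0|) (#|K_orbit q Tlast|).
move: (#|K_orbit q (ptR xi m.+1)|) (#|K_orbit q (ptQ xi m)|) => r1 r2 r12 t1 t2.
set sR := [seq j <- _ | _]; set sQ := [seq k <- _ | _].
pose fR j := (j * m, #|K_orbit q (ptR xi j)|.+2)%N.
pose fQ k := (kE k * m.+1, #|K_orbit q (ptQ xi k)|.+2)%N.
have -> : [seq (orbit_key \o ptR xi) j | j <- sR] = [seq fR j | j <- sR].
  by apply/eq_in_map => j; rewrite mem_jrange => /andP[_ /key_R].
have -> : [seq (orbit_key \o ptQ xi) k | k <- sQ] = [seq fQ k | k <- sQ].
  by apply/eq_in_map => k; rewrite mem_krange => /andP[_ /key_Q].
have R_level z : z \in [seq fR j | j <- sR] ->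
    [/\ (0 < z.1 < L)%N, z.1 != M, (1 < z.2)%N
      & exists2 j, (0 < j < q.+1)%N & z.1 = (j * m)%N].
  case/mapP=> j; rewrite mem_jrange => /andP[jm j_rg] -> /=.
  split; [exact: level_R_range | | by [] | by exists j].
  by apply: contra jm; rewrite /M [(m * _)%N]mulnC => /eqP/level_R_inj->.
have Q_level z : z \in [seq fQ k | k <- sQ] ->
    [/\ (0 < z.1 < L)%N, z.1 != M, (1 < z.2)%N
      & exists2 k, (0 < k < q.-1)%N & z.1 = (k * m.+1)%N].
  case/mapP=> k; rewrite mem_krange => /andP[km k_rg] -> /=.
  split; [exact/level_E_range/kE_range | | by [] | by exists (kE k); rewrite ?kE_range].
  apply: contra km; rewrite /M eqn_pmul2r // -[X in _ == X]kE_half => /eqP/kE_inj-> //.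
    by case/andP: k_rg.
  by case/andP: half_Q_range.
have RQ z : z \in [seq fR j | j <- sR] -> z \notin [seq fQ k | k <- sQ].
  case/R_level=> _ zM _ [j j_rg zj]; apply/negP => /Q_level[_ _ _ [k k_rg zk]].
  have [jm _] := level_R_E j_rg k_rg (etrans (esym zj) zk).
  by case/eqP: zM; rewrite zj jm mulnC.
rewrite (cat_uniq [:: _; _; _; _; _; _]) (cat_uniq [seq fR j | j <- sR]).
rewrite (cat_uniq [seq fQ k | k <- sQ]).
have -> : uniq [seq fR j | j <- sR].
  by rewrite map_inj_uniq ?filter_uniq ?iota_uniq // => j j' [/level_R_inj].
have -> : uniq [seq fQ k | k <- sQ].
  rewrite map_inj_in_uniq ?filter_uniq ?iota_uniq // => k k'; rewrite !mem_krange.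
  move=> /andP[_ /andP[_ k_lt]] /andP[_ /andP[_ k'_lt]] [/eqP + _].
  by rewrite eqn_pmul2r // => /eqP/kE_inj->.
rewrite -!all_predC; apply/and3P; split.
- by rewrite /= !inE !xpair_eqE; lia.
- apply/allP=> -[z1 z2]; rewrite !mem_cat.
  case/or3P=> [/R_level[/= z_rg zM z2_gt1 _] | /Q_level[/= z_rg zM z2_gt1 _] | ].
  + by rewrite /= !inE !xpair_eqE; lia.
  + by rewrite /= !inE !xpair_eqE; lia.
  by rewrite !inE => /orP[] /eqP->; rewrite /= !xpair_eqE; lia.
apply/and3P; split; first by [].
- apply/allP=> z; rewrite mem_cat /= => /orP[zQ|].
    by apply/negP => /RQ; rewrite zQ.
  by rewrite !inE => /orP[] /eqP->; apply/negP => /R_level[/=]; lia.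
apply/and3P; split; first by [].
- apply/allP=> z /=.
  by rewrite !inE => /orP[] /eqP->; apply/negP => /Q_level[/=]; lia.
by rewrite /= !inE !xpair_eqE; lia.
Qed.

Lemma K_orbits_reps : K_orbits F q = [set S in [seq K_orbit q X | X <- reps]].
Proof.
apply/setP=> S; rewrite inE; apply/imsetP/mapP => [[P _ ->] | [X _ ->]]; last by exists X.
by have [X Xreps /K_orbit_eqP->] := reps_cover P; exists X.
Qed.

Lemma orbit_list_reps :
  [:: ovoid F q; Sigma1 F q; Sigma2 q xi; quadric F :\: ovoid F q;
      K_orbit q (ptR xi m.+1); K_orbit q (ptQ xi m)]
  ++ [seq surfS q xi j :\: ovoid F q | j <- [seq j <- iota 1 q | j != (q.+1)./2]]
  ++ [seq surfE q xi (kE k) :\: ovoid F q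
       | k <- [seq k <- iota 1 (q - 2) | k != (q.-1)./2]]
  ++ [:: surfE q xi 0 :\: baer F q; surfE q xi q.-1 :\: baer F q]
  = [seq K_orbit q X | X <- reps].
Proof.
rewrite /reps !map_cat -!map_comp half_succ_q half_pred_q.
congr (_ ++ (_ ++ (_ ++ _))).
- by rewrite /= ovoidE -ovoidE quadric_orbit.
- by apply/eq_in_map=> j; rewrite mem_jrange => /andP[jm j_rg]; apply: surfS_orbit.
- by apply/eq_in_map=> k; rewrite mem_krange => /andP[km k_rg]; apply: surfE_orbit.
- by rewrite /= surfE0_orbit surfE_last_orbit.
Qed.

End Orbits.

Theorem proposition2p6 (p e q : nat) (F : finFieldType) (xi : F)
    (p_prime : prime p) (e_gt0 : (0 < e)%N) (q_def : q = (p ^ e)%N)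
    (q_odd : odd q) (cardF : #|F| = (q ^ 2)%N)
    (xi_primitive : ((q ^ 2).-1).-primitive_root xi) :
  let O := ovoid F q in
  let Sigma := baer F q in
  let kE (k : nat) := if (q %% 4 == 1)%N then k else (q.-1 - k)%N in
  let jrange := [seq j <- iota 1 q | j != (q.+1)./2] in
  let krange := [seq k <- iota 1 (q - 2) | k != (q.-1)./2] in
  exists H1 H2 : {set point F},
    let orbits :=
      [:: O; Sigma1 F q; Sigma2 q xi; quadric F :\: O; H1; H2]
      ++ [seq surfS q xi j :\: O | j <- jrange]
      ++ [seq surfE q xi (kE k) :\: O | k <- krange]
      ++ [:: surfE q xi 0 :\: Sigma; surfE q xi q.-1 :\: Sigma] in
    [/\ #|K_orbits F q| = (2 * q + 4)%N,
        K_orbits F q = [set X in orbits]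
      & uniq orbits] /\
    [/\ ptS1 F \in Sigma1 F q,
        ptS2 q xi \in Sigma2 q xi,
        Sigma1 F q :|: Sigma2 q xi = Sigma :\: O
      & #|Sigma1 F q| = #|Sigma2 q xi|] /\
    ptU F \in quadric F :\: O /\
    [/\ H1 :|: H2 = herm_surface F q :\: O,
        ptR xi (q.+1)./2 \in H1,
        ptQ xi (q.-1)./2 \in H2,
        #|H1| = (q ^ 2 * (q ^ 2 + 1) * (q - 1) %/ 2)%N
      & #|H2| = (q ^ 2 * (q ^ 2 + 1) * (q + 1) %/ 2)%N] /\
    (forall j : nat, j \in jrange -> ptR xi j \in surfS q xi j :\: O) /\
    (forall k : nat, k \in krange ->
       ptQ xi k \in surfE q xi (kE k) :\: O) /\
    (if (q %% 4 == 1)%N then ptT1 xi else ptT2 q xi)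
      \in surfE q xi 0 :\: Sigma /\
    (if (q %% 4 == 1)%N then ptT2 q xi else ptT1 xi)
      \in surfE q xi q.-1 :\: Sigma.
Proof.
move=> O Sigma kE_ jrange krange.
have mE1 := half_succ_q p_prime q_def q_odd cardF xi_primitive.
have mE2 := half_pred_q p_prime q_def q_odd cardF xi_primitive.
have refl (P : point F) : P \in K_orbit q P by exact: (K_orbit_refl p_prime q_def cardF).
(* As q is odd, [q./2] is (q - 1) / 2, so these are the orbits of the two prescribed
   representatives. *)
exists (K_orbit q (ptR xi q./2.+1)), (K_orbit q (ptQ xi q./2)); move=> orbits.
have orbitsE : orbits = [seq K_orbit q X | X <- reps q xi].
  exact: (orbit_list_reps p_prime q_def q_odd cardF xi_primitive).
have uniq_list : uniq orbits.
  by rewrite orbitsE; exact: (uniq_orbits p_prime q_def q_odd cardF xi_primitive).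
have listE : K_orbits F q = [set X in orbits].
  by rewrite orbitsE; exact: (K_orbits_reps p_prime q_def q_odd cardF xi_primitive).
split.
  split=> //; rewrite listE cardsE (card_uniqP uniq_list) orbitsE size_map.
  exact: (size_reps p_prime q_def q_odd cardF xi_primitive).
split.
  split; [exact: refl | exact: refl | |].
  - exact: (baer_orbits p_prime q_def q_odd cardF xi_primitive).
  - exact: (card_Sigma12 p_prime q_def q_odd cardF xi_primitive).
split.
  by rewrite /O (quadric_orbit p_prime q_def q_odd cardF xi_primitive) refl.
split.
  rewrite mE1 mE2; split; [| exact: refl | exact: refl | |].
  - exact: (herm_surface_orbits p_prime q_def q_odd cardF xi_primitive).
  - exact: (card_orbit_R p_prime q_def q_odd cardF xi_primitive).
  - exact: (card_orbit_Q p_prime q_def q_odd cardF xi_primitive).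
split.
  move=> j; rewrite /jrange mE1 mem_jrange => /andP[jm j_rg].
  by rewrite /O (surfS_orbit p_prime q_def q_odd cardF xi_primitive j_rg jm) refl.
split.
  move=> k; rewrite /krange mE2 (mem_krange p_prime q_def q_odd cardF xi_primitive).
  case/andP=> km k_rg.
  rewrite /O -[kE_ k]/(kE q k).
  by rewrite (surfE_orbit p_prime q_def q_odd cardF xi_primitive k_rg km) refl.
split.
  by rewrite /Sigma (surfE0_orbit p_prime q_def q_odd cardF xi_primitive) refl.
by rewrite /Sigma (surfE_last_orbit p_prime q_def q_odd cardF xi_primitive) refl.
Qed.
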